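(* Let $\Lambda$ be a locally square-integrable invariant (simple) point process in $\mathbb{R}^d$ with centered diffraction $\widehat{\eta}$. Suppose that there are $\delta>0$ and a sequence $\varepsilon_n\searrow0$ of positive reals such that $$\widehat{\eta}(B_{\varepsilon_n})\ll\varepsilon_n^{2d+\delta}$$ with an implied constant independent of $n$, where $B_\varepsilon$ denotes the Euclidean ball of radius $\varepsilon$ around $0$ in $\mathbb{R}^d$. Then $\Lambda$ is number rigid.
   Context: An invariant simple point process in $\mathbb{R}^d$ is an $\mathbb{R}^d$-equivariant measurable map $\omega\mapsto\Lambda_\omega$ from a standard probability space $(\Omega,\mathbb{P})$ with a probability-measure-preserving $\mathbb{R}^d$-action to the locally finite subsets of $\mathbb{R}^d$ (with $\mathbb{R}^d$ acting by translations). It is locally square-integrable if $\mathbb{E}[\#(\Lambda\cap B)^2]<\infty$ for every bounded Borel set $B$. Centered diffraction: there is a unique signed Radon measure $\eta$ on $\mathbb{R}^d$ with $\eta(f*f^* )=\mathrm{Var}\big(\sum_{x\in\Lambda}f(x)\big)$ for all bounded Borel $f$ with bounded support, where $f^*(x)=\overline{f(-x)}$; it is positive-definite and $\widehat{\eta}$ is its Fourier transform, a positive Radon measure on $\mathbb{R}^d$ satisfying $\int|\widehat f|^2d\widehat\eta=\mathrm{Var}\big(\sum_{x\in\Lambda}f(x)\big)$ with $\widehat f(\xi)=\int f(x)e^{-2\pi i\langle x,\xi\rangle}dx$. $\Lambda$ is number rigid if for every bounded Borel set $B\subset\mathbb{R}^d$ there is a conull set $\Omega_B\subset\Omega$ such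 that for $\omega\in\Omega_B$ the number $\#(\Lambda_\omega\cap B)$ depends only on $\Lambda_\omega\cap B^c$ (i.e. if $\omega,\omega'\in\Omega_B$ and $\Lambda_\omega\cap B^c=\Lambda_{\omega'}\cap B^c$, then $\#(\Lambda_\omega\cap B)=\#(\Lambda_{\omega'}\cap B)$). *)

(* Defs.v *)
From HB Require Import structures.
From mathcomp Require Import all_boot all_order all_algebra.
From mathcomp Require Import all_classical all_reals all_analysis.
From mathcomp Require Import finmap measurable_realfun complex.

Set Implicit Arguments.
Unset Strict Implicit.
Unset Printing Implicit Defensive.

Import Order.TTheory GRing.Theory Num.Theory.
Import numFieldNormedType.Exports.
Local Open Scope classical_set_scope.
Local Open Scope ring_scope.

Definition borel_rV_display : measure_display.
Proof. exact: default_measure_display. Qed.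

Section borel_rV.
Context {R : realType} {d : nat}.

Definition borel_rV : set (set 'rV[R]_d) := <<s [set U | open U] >>.

HB.instance Definition _ := @isMeasurable.Build borel_rV_display 'rV[R]_d
  borel_rV (@sigma_algebra0 _ setT _) (@sigma_algebraC _ _)
  (@sigma_algebra_bigcup _ setT _).

Lemma measurable_coord (i : 'I_d) :
  measurable_fun [set: 'rV[R]_d] (fun x : 'rV[R]_d => x ord0 i).
Proof.
apply: (measurability _ (RGenOpens.measurableE R)) => _ [_ [a [b ->]] <-].
rewrite setTI; apply: sub_sigma_algebra => /=.
by apply: open_comp; [move=> x _; exact: coord_continuous|exact: interval_open].
Qed.

Let box (a b : 'rV[rat]_d) : set 'rV[R]_d :=
  [set x | forall i, ratr (a ord0 i) < x ord0 i < ratr (b ord0 i)].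

Let open_box (U : set 'rV[R]_d) (x : 'rV[R]_d) : open U -> U x ->
  exists ab, box ab.1 ab.2 x /\ box ab.1 ab.2 `<=` U.
Proof.
move=> oU Ux; have : nbhs x U by exact: open_nbhs_nbhs.
move=> [Q Qx QU].
have H i : {ab : rat * rat | ratr ab.1 < x ord0 i < ratr ab.2 /\
    `](ratr ab.1), (ratr ab.2)[ `<=` Q ord0 i}.
  apply/cid; have /nbhs_ballP[e /= e0 eQ] := Qx ord0 i.
  have /rat_in_itvoo[a /itvP aE] : x ord0 i - e < x ord0 i.
    by rewrite ltrBlDr ltrDl.
  have /rat_in_itvoo[b /itvP bE] : x ord0 i < x ord0 i + e by rewrite ltrDl.
  exists (a, b); split => /=; first by rewrite aE bE.
  move=> y /=; rewrite in_itv/= => /andP[ay yb]; apply: eQ.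
  rewrite /ball/= ltr_distlC.
  rewrite (lt_trans _ ay) ?aE//=.
  by rewrite (lt_trans yb)// bE.
exists (\row_i (sval (H i)).1, \row_i (sval (H i)).2); split => /=.
  by move=> i; rewrite !mxE; case: (H i) => ab [].
move=> y yab; apply: QU => i j; rewrite (ord1 i).
have := yab j; rewrite !mxE; case: (H j) => ab /= [_ abQ] yj.
by apply: abQ; rewrite /= in_itv.
Qed.

Lemma measurable_fun_rV d' (T : measurableType d') (f : T -> 'rV[R]_d) :
  (forall i, measurable_fun setT (fun t => f t ord0 i)) ->
  measurable_fun setT f.
Proof.
move=> mf; apply: (@measurability _ _ _ _ _ _ [set U : set 'rV[R]_d | open U]).
  by [].
move=> _ [U /= oU <-]; rewrite setTI.
pose A := [set ab | box ab.1 ab.2 `<=` U].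
have -> : f @^-1` U = \bigcup_(ab in A) f @^-1` (box ab.1 ab.2).
  apply/seteqP; split => [t /= Uft|t [ab/= abU]]; last exact: abU.
  by have [ab [xab abU]] := open_box oU Uft; exists ab.
rewrite bigcup_mkcond; apply: countable_bigcupT_measurable => // ab.
case: ifPn => // _.
have -> : f @^-1` box ab.1 ab.2 = \big[setI/setT]_(i < d)
    ((fun t => f t ord0 i) @^-1` `](ratr (ab.1 ord0 i)), (ratr (ab.2 ord0 i))[).
  rewrite -bigcap_seq; apply/seteqP; split => [t /= tab i _|t /= tab i].
    by rewrite /= in_itv/=; exact: tab.
  by have := tab i (mem_index_enum i); rewrite /= in_itv.
apply: bigsetI_measurable => i _; rewrite -[X in measurable X]setTI.
exact: mf.
Qed.

End borel_rV.

Section lebesgue_rV.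
Context {R : realType}.
Local Open Scope ereal_scope.

Definition cons_rV {d : nat} (p : measurableTypeR R * 'rV[R]_d) : 'rV[R]_d.+1 :=
  \row_i oapp (p.2 ord0) p.1 (unlift ord0 i).

Lemma measurable_cons_rV d : measurable_fun setT (@cons_rV d).
Proof.
apply: measurable_fun_rV => i.
case: (unliftP ord0 i) => [j ->|->].
  rewrite (_ : (fun _ => _) = (fun x : 'rV[R]_d => x ord0 j) \o snd); last first.
    by apply/funext => p /=; rewrite mxE liftK.
  by apply: measurableT_comp => //; exact: measurable_coord.
rewrite (_ : (fun _ => _) = fst)//.
by apply/funext => p /=; rewrite mxE unlift_none.
Qed.

Let uncons_rV {d : nat} (x : 'rV[R]_d.+1) : measurableTypeR R * 'rV[R]_d :=
  (x ord0 ord0, \row_i x ord0 (lift ord0 i)).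

Let cons_rVK d : cancel (@cons_rV d) uncons_rV.
Proof.
move=> [a x]; rewrite /uncons_rV /cons_rV !mxE unlift_none/=; congr pair.
by apply/rowP => i; rewrite !mxE liftK.
Qed.

Let measurable_uncons_rV d : measurable_fun setT (@uncons_rV d).
Proof.
apply: measurable_fun_pair; first exact: measurable_coord.
apply: measurable_fun_rV => i.
rewrite (_ : (fun _ => _) = fun x : 'rV[R]_d.+1 => x ord0 (lift ord0 i)).
  exact: measurable_coord.
by apply/funext => x; rewrite mxE.
Qed.

Section step.
Variables (d : nat) (mu : {sigma_finite_measure set 'rV[R]_d -> \bar R}).

Definition lebesgue_rV_step : set 'rV[R]_d.+1 -> \bar R :=
  pushforward (lebesgue_measure \x mu) (@cons_rV d).

Let step0 : lebesgue_rV_step set0 = 0.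
Proof. by rewrite /lebesgue_rV_step /pushforward preimage_set0 measure0. Qed.

Let step_ge0 A : 0 <= lebesgue_rV_step A.
Proof. by rewrite /lebesgue_rV_step /pushforward; exact: measure_ge0. Qed.

Let step_sigma_additive : semi_sigma_additive lebesgue_rV_step.
Proof.
move=> F mF tF mUF.
rewrite /lebesgue_rV_step; apply: measure_semi_sigma_additive => //.
exact: measurable_cons_rV.
Qed.

HB.instance Definition _ := isMeasure.Build _ _ _ lebesgue_rV_step
  step0 step_ge0 step_sigma_additive.

Let step_sigma_finite : sigma_finite setT lebesgue_rV_step.
Proof.
have /sigma_finiteP[F [TF ndF Foo]] := sigma_finiteT (@lebesgue_measure R).
have /sigma_finiteP[G [TG ndG Goo]] := sigma_finiteT mu.
exists (fun n => uncons_rV @^-1` (F n `*` G n)).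
  rewrite -preimage_bigcup; apply/esym/seteqP; split => // x _.
  have [n _ Fn] : (\bigcup_n F n) (uncons_rV x).1 by rewrite -TF.
  have [m _ Gm] : (\bigcup_n G n) (uncons_rV x).2 by rewrite -TG.
  exists (maxn n m) => //; split.
  - by move: Fn; exact/subsetPset/ndF/leq_maxl.
  - by move: Gm; exact/subsetPset/ndG/leq_maxr.
move=> n; have [mF Fn] := Foo n; have [mG Gn] := Goo n; split.
  rewrite -[X in measurable X]setTI; apply: measurable_uncons_rV => //.
  exact: measurableX.
rewrite /lebesgue_rV_step /pushforward -comp_preimage.
rewrite (_ : _ \o _ = id); last by apply/funext => p /=; exact: cons_rVK.
by rewrite preimage_id product_measure1E// lte_mul_pinfty// ge0_fin_numE.
Qed.

HB.instance Definition _ := Measure_isSigmaFinite.Build _ _ _ lebesgue_rV_step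
  step_sigma_finite.

End step.

(** On [R^0] Lebesgue measure is the unit mass; on [R^d.+1] it is the image of
    the product of the measures on [R] and [R^d], see [lebesgue_rV_box]. *)
Fixpoint lebesgue_rV (d : nat) : {sigma_finite_measure set 'rV[R]_d -> \bar R} :=
  if d is d'.+1 then lebesgue_rV_step (lebesgue_rV d')
  else \d_ (0%R : 'rV[R]_0).

Lemma lebesgue_rV_box d (a b : 'rV[R]_d) : (forall i, a ord0 i <= b ord0 i)%R ->
  lebesgue_rV d [set x | forall i, (a ord0 i <= x ord0 i <= b ord0 i)%R] =
  (\prod_(i < d) (b ord0 i - a ord0 i)%R)%:E.
Proof.
elim: d => [|d IH] in a b * => ab.
  rewrite big_ord0 /= /dirac /= indicE.
  by rewrite mem_set// => -[].
pose a' := \row_i a ord0 (lift ord0 i); pose b' := \row_i b ord0 (lift ord0 i).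
have a'b' i : (a' ord0 i <= b' ord0 i)%R by rewrite !mxE.
have := IH a' b' a'b'.
pose A := [set x : 'rV[R]_d | forall i, (a' ord0 i <= x ord0 i <= b' ord0 i)%R].
rewrite -/A => IHE.
have mA : measurable A.
  rewrite (_ : A = \big[setI/setT]_(i < d) (fun x : 'rV[R]_d => x ord0 i) @^-1`
      `[a' ord0 i, b' ord0 i]%classic).
    apply: bigsetI_measurable => i _; rewrite -[X in measurable X]setTI.
    by apply: measurable_coord => //; exact: measurable_itv.
  rewrite -bigcap_seq; apply/seteqP; split => [x /= xA i _|x /= xA i].
    by rewrite /= in_itv/=; exact: xA.
  by have := xA i (mem_index_enum i); rewrite /= in_itv.
rewrite /= /lebesgue_rV_step /pushforward.
rewrite (_ : _ @^-1` _ = `[a ord0 ord0, b ord0 ord0] `*` A).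
  rewrite product_measure1E//=.
  rewrite [X in _ * X](IHE : lebesgue_rV d A = _).
  rewrite [X in X * _]lebesgue_measure_itv/= lte_fin.
  have -> : (if (a ord0 ord0 < b ord0 ord0)%R
      then (b ord0 ord0)%:E - (a ord0 ord0)%:E else 0) =
      (b ord0 ord0 - a ord0 ord0)%:E.
    case: ltP => [_|ba]; first by rewrite EFinB.
    by rewrite (_ : a ord0 ord0 = b ord0 ord0) ?subrr//; apply/le_anti; rewrite ab ba.
  rewrite big_ord_recl EFinM; congr (_ * _%:E).
  by apply: eq_bigr => i _; rewrite !mxE.
apply/seteqP; split => -[x y] /=.
  move=> xy; split => [|i] /=.
    by have := xy ord0; rewrite mxE unlift_none/= in_itv.
  by have := xy (lift ord0 i); rewrite !mxE liftK.
move=> [xab yA] i; rewrite mxE; case: (unliftP ord0 i) => [j ->|->].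
  by have := yA j; rewrite !mxE.
by move: xab; rewrite in_itv.
Qed.

End lebesgue_rV.

Section complex_valued.
Context {R : realType}.

Definition sqr_normc (z : R[i]) : R := complex.Re z ^+ 2 + complex.Im z ^+ 2.

Definition cexp (t : R) : R[i] := (cos t +i* sin t)%C.

Definition cintegral {disp} {T : measurableType disp}
    (mu : {measure set T -> \bar R}) (g : T -> R[i]) : R[i] :=
  ((\int[mu]_x complex.Re (g x)) +i* (\int[mu]_x complex.Im (g x)))%C.

Definition cmeasurable {disp} {T : measurableType disp} (g : T -> R[i]) : Prop :=
  measurable_fun setT (fun x => complex.Re (g x)) /\
  measurable_fun setT (fun x => complex.Im (g x)).

(** [E |X - E X|^2], for [X] square-integrable. *)
Definition cvariance {disp} {T : measurableType disp} (P : probability T R)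
    (X : T -> R[i]) : R :=
  \int[P]_w sqr_normc (X w - cintegral P X).

End complex_valued.

Section fourier.
Context {R : realType} {d : nat}.
Implicit Types (x y xi : 'rV[R]_d) (f g : 'rV[R]_d -> R[i]).

Definition inner x y : R := \sum_(i < d) x ord0 i * y ord0 i.

(** The library norm on ['rV[R]_d] is the sup norm, hence the explicit formula. *)
Definition eball (r : R) : set 'rV[R]_d := [set x | Num.sqrt (inner x x) < r].

Definition test_function f : Prop :=
  [/\ cmeasurable f,
      exists M : R, forall x, sqr_normc (f x) <= M &
      bounded_set [set x | f x != 0]].

Definition involution f x : R[i] := conjc (f (- x)).

Definition convolution f g x : R[i] :=
  cintegral (lebesgue_rV d) (fun y => f y * g (x - y)).

Definition fourier f xi : R[i] :=
  cintegral (lebesgue_rV d) (fun x => f x * cexp (- (2 * pi * inner x xi))).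

(** Every locally finite Borel measure on R^d is regular, hence Radon. *)
Definition radon (mu : {measure set 'rV[R]_d -> \bar R}) : Prop :=
  forall K : set 'rV[R]_d, compact K -> (mu K < +oo)%E.

(** A signed Radon measure is a difference of two Radon measures; it is in
    general infinite on unbounded sets, so it is not a [charge], and only acts
    on functions with bounded support. *)
Record signed_radon := SignedRadon {
  sr_pos : {measure set 'rV[R]_d -> \bar R};
  sr_neg : {measure set 'rV[R]_d -> \bar R};
  sr_pos_radon : radon sr_pos;
  sr_neg_radon : radon sr_neg }.

Definition sr_integral (eta : signed_radon) g : R[i] :=
  cintegral (sr_pos eta) g - cintegral (sr_neg eta) g.

(** The Fourier transform of a positive-definite measure [eta] is the unique
    positive Radon measure [etahat] satisfying Plancherel's formula
    [eta (f * f^* ) = \int |fourier f|^2 d etahat]. *)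
Definition is_fourier_transform (eta : signed_radon)
    (etahat : {measure set 'rV[R]_d -> \bar R}) : Prop :=
  radon etahat /\
  forall f, test_function f ->
    etahat.-integrable setT (fun xi => (sqr_normc (fourier f xi))%:E) /\
    sr_integral eta (convolution f (involution f)) =
      (\int[etahat]_xi sqr_normc (fourier f xi))%:C%C.

End fourier.
Arguments signed_radon : clear implicits.

(** A Polish metric [dist] and its Borel sigma-algebra. *)
Definition standard_borel (R : realType) {disp} (T : measurableType disp) : Prop :=
  exists dist : T -> T -> R,
    [/\ (forall x y, (dist x y = 0) <-> (x = y)),
        (forall x y, dist x y = dist y x) &
        (forall x y z, dist x z <= dist x y + dist y z)] /\
    [/\ (forall u : nat -> T,
          (forall e, 0 < e -> exists N, forall m n,
             (N <= m)%N -> (N <= n)%N -> dist (u m) (u n) < e) ->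
          exists l, forall e, 0 < e -> exists N, forall n,
             (N <= n)%N -> dist (u n) l < e),
        (exists u : nat -> T, forall x e, 0 < e -> exists n, dist (u n) x < e) &
        @measurable disp T = <<s [set U : set T | forall x, U x ->
          exists2 e, 0 < e & [set y | dist x y < e] `<=` U] >>].

Section point_process.
Context {R : realType} {d : nat} {disp : measure_display}
  {Omega : measurableType disp}.
Variable P : probability Omega R.
Implicit Types (act : 'rV[R]_d -> Omega -> Omega)
  (Lambda : Omega -> set 'rV[R]_d).

Definition pmp_action act : Prop :=
  [/\ (forall w, act 0 w = w),
      (forall x y w, act (x + y) w = act x (act y w)),
      measurable_fun setT (fun xw : 'rV[R]_d * Omega => act xw.1 xw.2) &
      (forall x A, measurable A -> P (act x @^-1` A) = P A)].

(** Meaningful for finite [A] only: [fset_set] is empty on infinite sets. *)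
Definition npoints (A : set 'rV[R]_d) : nat := #|` fset_set A|%fset.

(** Measurability is with respect to the sigma-algebra on locally finite sets
    generated by the maps counting the points in bounded Borel sets. *)
Definition invariant_point_process act Lambda : Prop :=
  [/\ (forall w (B : set 'rV[R]_d), bounded_set B ->
        finite_set (Lambda w `&` B)),
      (forall B : set 'rV[R]_d, measurable B -> bounded_set B ->
        measurable_fun setT (fun w => npoints (Lambda w `&` B))) &
      (forall x w, Lambda (act x w) = [set y + x | y in Lambda w])].

Definition locally_square_integrable Lambda : Prop :=
  forall B : set 'rV[R]_d, measurable B -> bounded_set B ->
    ('E_P[fun w => ((npoints (Lambda w `&` B))%:R ^+ 2)%R] < +oo)%E.

(** The sum over [Lambda w] has finitely many nonzero terms when [f] has
    bounded support. *)
Definition linear_statistic Lambda (f : 'rV[R]_d -> R[i]) (w : Omega) : R[i] :=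
  \sum_(x \in Lambda w) f x.

Definition is_centered_autocorrelation Lambda (eta : signed_radon R d) : Prop :=
  forall f, test_function f ->
    sr_integral eta (convolution f (involution f)) =
      (cvariance P (linear_statistic Lambda f))%:C%C.

Definition is_centered_diffraction Lambda
    (etahat : {measure set 'rV[R]_d -> \bar R}) : Prop :=
  exists2 eta : signed_radon R d,
    is_centered_autocorrelation Lambda eta & is_fourier_transform eta etahat.

Definition number_rigid Lambda : Prop :=
  forall B : set 'rV[R]_d, measurable B -> bounded_set B ->
    exists2 OmegaB : set Omega, P.-negligible (~` OmegaB) &
      forall w w', OmegaB w -> OmegaB w' ->
        Lambda w `&` ~` B = Lambda w' `&` ~` B ->
        npoints (Lambda w `&` B) = npoints (Lambda w' `&` B).

End point_process.

(* Main.v *)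
Require Import Defs.
From mathcomp Require Import all_boot all_order all_algebra.
From mathcomp Require Import all_classical all_reals all_analysis.
From mathcomp Require Import finmap measurable_realfun complex ring lra.
(* Imported again because mathcomp's [complex] has a lemma named [sqr_normc]. *)
Require Import Defs.

(** Fix a scale [L] and test functions [f_L(x) = prod_i (1 - (x_i/L)^2)^N], cut
    off outside the cube [[-L, L]^d].  They tend to [1] pointwise, and
    integrating by parts [N] times gives
    [|hat f_L(xi)|^2 << L^(2d) prod_i (1 + (2 pi L xi_i)^2)^(-N)].  The weight
    [w(xi) = prod_i (1 + (2 pi xi_i)^2)^-1] is [etahat]-integrable, since up to a
    constant it is at most [|hat g|^2] for [g(x) = prod_i e^(-x_i)] on [[0, 1]^d],
    whose Fourier transform has no zeros.  Outside the ball of radius [eps_n] one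
    has [|hat f_L|^2 << L^(2d) (L eps_n)^(-2(N-1)) w], so for
    [L = eps_n^(-1-kappa)] with [kappa] small and [N] large both the ball and its
    complement contribute [o(1)] to [Var (sum f_L) = int |hat f_L|^2 d etahat].
    Along a subsequence the centred linear statistics tend to [0] almost surely;
    for two configurations that agree outside [B], the difference of their
    statistics tends both to [0] and to the difference of their numbers of points
    in [B]. *)

Set Implicit Arguments.
Unset Strict Implicit.
Unset Printing Implicit Defensive.

Import Order.TTheory GRing.Theory Num.Theory.
Import numFieldNormedType.Exports.
Local Open Scope classical_set_scope.
Local Open Scope ring_scope.

(** * Trigonometric moments on a segment *)

Section trigonometric_moments.
Context {R : realType}.
Implicit Types (u v f F : R -> R) (a b s x : R).
Notation mu := (@lebesgue_measure R).

Lemma is_derive_mul (f g : R -> R) (x df dg : R) :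
  is_derive x 1 f df -> is_derive x 1 g dg ->
  is_derive x 1 (fun y => f y * g y) (df * g x + f x * dg).
Proof.
move=> Df Dg; have := is_deriveM Df Dg.
by rewrite /GRing.scale/= addrC (mulrC (g x)).
Qed.

Lemma is_derive_lin2 (f g : R -> R) (c e x df dg : R) :
  is_derive x 1 f df -> is_derive x 1 g dg ->
  is_derive x 1 (fun y => c * f y + e * g y) (c * df + e * dg).
Proof. by move=> Df Dg; exact: is_deriveD (is_deriveZ c Df) (is_deriveZ e Dg). Qed.

Lemma continuous_is_derive (f f' : R -> R) :
  (forall x : R, is_derive x 1 f (f' x)) -> continuous f.
Proof.
move=> df x; apply: differentiable_continuous; apply/derivable1_diffP.
exact: (@ex_derive _ _ _ _ _ _ _ (df x)).
Qed.

Lemma continuous_mul (f g : R -> R) :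
  continuous f -> continuous g -> continuous (fun x => f x * g x).
Proof. by move=> cf cg x; apply: cvgM; [exact: cf|exact: cg]. Qed.

Lemma continuous_mull (c : R) (f : R -> R) :
  continuous f -> continuous (fun x => c * f x).
Proof. by apply: continuous_mul => x; exact: cvg_cst. Qed.

Lemma continuous_add (f g : R -> R) :
  continuous f -> continuous g -> continuous (fun x => f x + g x).
Proof. by move=> cf cg x; apply: cvgD; [exact: cf|exact: cg]. Qed.

Lemma Rintegral_FTC2 f F a b : a < b ->
  (forall x : R, is_derive x 1 F (f x)) -> continuous f ->
  \int[mu]_(x in `[a, b]) f x = F b - F a.
Proof.
move=> ab dF cf; have cF : continuous F by exact: continuous_is_derive dF.
rewrite /Rintegral (@continuous_FTC2 _ f F)//.
- exact: continuous_subspaceT.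
- split.
  + by move=> x _; exact: (@ex_derive _ _ _ _ _ _ _ (dF x)).
  + by apply: cvg_at_right_filter; exact: cF.
  + by apply: cvg_at_left_filter; exact: cF.
- by move=> x _; rewrite derive1E; exact: (@derive_val _ _ _ _ _ _ _ (dF x)).
Qed.

Lemma continuous_integrable_segment f a b : continuous f ->
  mu.-integrable `[a, b] (EFin \o f).
Proof.
move=> cf; apply: continuous_compact_integrable; first exact: segment_compact.
exact: continuous_subspaceT.
Qed.

Definition cosint u a b s := \int[mu]_(x in `[a, b]) (u x * cos (s * x)).
Definition sinint u a b s := \int[mu]_(x in `[a, b]) (u x * sin (s * x)).

Lemma is_derive_mulrl s x : is_derive x 1 (fun y => s * y) s.
Proof.
by have := is_deriveZ s (is_derive_id x 1); rewrite /GRing.scale/= mulr1.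
Qed.

Lemma is_derive_cosM s x : is_derive x 1 (fun y => cos (s * y)) (- (s * sin (s * x))).
Proof.
have := @is_derive1_comp _ cos _ x _ _ (is_derive_cos _) (is_derive_mulrl s x).
by move=> /is_derive_eq; apply; rewrite mulNr mulrC.
Qed.

Lemma is_derive_sinM s x : is_derive x 1 (fun y => sin (s * y)) (s * cos (s * x)).
Proof.
have := @is_derive1_comp _ sin _ x _ _ (is_derive_sin _) (is_derive_mulrl s x).
by move=> /is_derive_eq; apply; rewrite mulrC.
Qed.

Lemma continuous_cosM s : continuous (fun y : R => cos (s * y)).
Proof. by apply: continuous_is_derive => x; exact: is_derive_cosM. Qed.

Lemma continuous_sinM s : continuous (fun y : R => sin (s * y)).
Proof. by apply: continuous_is_derive => x; exact: is_derive_sinM. Qed.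

(** The derivatives of [u x * cos (s * x)] and [u x * sin (s * x)] integrate to 0 because [u]
    vanishes at both ends. Keeping the factor [s] on the left avoids a division, so that [s = 0] is
    allowed. *)
Lemma cosint_sinint_parts u v a b s : a < b ->
  (forall x : R, is_derive x 1 u (v x)) -> continuous v -> u a = 0 -> u b = 0 ->
  s * cosint u a b s = - sinint v a b s /\ s * sinint u a b s = cosint v a b s.
Proof.
move=> ab du cv ua ub; have cu : continuous u by exact: continuous_is_derive du.
have := @Rintegral_FTC2 (fun x => v x * sin (s * x) + s * (u x * cos (s * x)))
  (fun x => u x * sin (s * x)) a b ab.
have := @Rintegral_FTC2 (fun x => v x * cos (s * x) + (- s) * (u x * sin (s * x)))
  (fun x => u x * cos (s * x)) a b ab.
rewrite ua ub !mul0r subrr => H1 H2.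
have ccos := @continuous_cosM s; have csin := @continuous_sinM s.
have {H1} : \int[mu]_(x in `[a, b])
    (v x * cos (s * x) + (- s) * (u x * sin (s * x))) = 0.
  apply: H1.
    move=> x; apply: (is_derive_eq (is_derive_mul (du x) (is_derive_cosM s x))).
    by ring.
  by apply: continuous_add; [|apply: continuous_mull]; exact: continuous_mul.
have {H2} : \int[mu]_(x in `[a, b])
    (v x * sin (s * x) + s * (u x * cos (s * x))) = 0.
  apply: H2.
    move=> x; apply: (is_derive_eq (is_derive_mul (du x) (is_derive_sinM s x))).
    by ring.
  by apply: continuous_add; [|apply: continuous_mull]; exact: continuous_mul.
rewrite !RintegralD// ?RintegralZl//; first last.
all: try by apply: continuous_integrable_segment; first
  [exact: continuous_mul | apply: continuous_mull; exact: continuous_mul].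
rewrite -/(cosint _ _ _ _) -/(sinint _ _ _ _) -/(cosint _ _ _ _) -/(sinint _ _ _ _).
by move=> H1 H2; split; lra.
Qed.

(** Squared modulus of the Fourier integral of [u] over the segment at angular frequency [s]: the
    two moments are its real part and, up to sign, its imaginary part. *)
Definition trig_power u a b s := cosint u a b s ^+ 2 + sinint u a b s ^+ 2.

(** Explicit primitives give the exact value [|1 - e^(-1-is)|^2 / (1 + s^2)], and the modulus in the
    numerator is at least [1 - e^(-1)]. This is what keeps the transform of the truncated
    exponential away from 0. *)
Lemma trig_power_expN s :
  (1 - (expR 1)^-1) ^+ 2 / (1 + s ^+ 2) <=
  trig_power (fun x => expR (- x)) 0 1 s.
Proof.
have s0 : 1 + s ^+ 2 != 0 by rewrite gt_eqF// ltr_pwDl// sqr_ge0.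
have dE (x : R) : is_derive x 1 (fun y => expR (- y)) (- expR (- x) : R).
  have := @is_derive1_comp _ (@expR R) _ x _ _ (is_derive_expR _)
    (is_derive_mulrl (-1) x).
  rewrite mulN1r => /is_derive_eq de; rewrite (_ : (fun _ => _) = expR \o ( *%R (-1))).
    by apply: de; rewrite mulrN1.
  by apply/funext => y /=; rewrite mulN1r.
have cE : continuous (fun y : R => expR (- y)) by exact: continuous_is_derive dE.
have C : cosint (fun x => expR (- x)) 0 1 s =
    (expR (-1) * (s * sin s - cos s) + 1) / (1 + s ^+ 2).
  have FT := @Rintegral_FTC2 (fun x => expR (- x) * cos (s * x)) (fun x => expR (- x) *
    ((s / (1 + s ^+ 2)) * sin (s * x) + (- (1 + s ^+ 2)^-1) * cos (s * x))) 0 1 ltr01.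
  apply: etrans; first apply: FT.
  - move=> x; apply: (is_derive_eq (is_derive_mul (dE x)
      (is_derive_lin2 _ _ (is_derive_sinM s x) (is_derive_cosM s x)))).
    by field.
  - by apply: continuous_mul => //; exact: continuous_cosM.
  - rewrite oppr0 expR0 !(mulr0,mulr1) sin0 cos0; by field.
have S : sinint (fun x => expR (- x)) 0 1 s =
    (s - expR (-1) * (sin s + s * cos s)) / (1 + s ^+ 2).
  have FT := @Rintegral_FTC2 (fun x => expR (- x) * sin (s * x)) (fun x => expR (- x) *
    ((- (1 + s ^+ 2)^-1) * sin (s * x) + (- s / (1 + s ^+ 2)) * cos (s * x))) 0 1 ltr01.
  apply: etrans; first apply: FT.
  - move=> x; apply: (is_derive_eq (is_derive_mul (dE x)
      (is_derive_lin2 _ _ (is_derive_sinM s x) (is_derive_cosM s x)))).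
    by field.
  - by apply: continuous_mul => //; exact: continuous_sinM.
  - rewrite oppr0 expR0 !(mulr0,mulr1) sin0 cos0; by field.
rewrite /trig_power C S -expRN; set E := expR (-1).
have -> : ((E * (s * sin s - cos s) + 1) / (1 + s ^+ 2)) ^+ 2 +
    ((s - E * (sin s + s * cos s)) / (1 + s ^+ 2)) ^+ 2 =
    (E ^+ 2 * (cos s ^+ 2 + sin s ^+ 2) - 2 * E * cos s + 1) / (1 + s ^+ 2).
  by field.
rewrite cos2Dsin2 mulr1 ler_pM2r ?invr_gt0 ?ltr_pwDl ?sqr_ge0//.
have /= := cos_le1 s; have := expR_gt0 (-1 : R); rewrite -/E => E0 c1.
nra.
Qed.

(** * Fourier decay of polynomial bumps *)

Lemma horner_bounded (p : {poly R}) (L : R) :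
  exists2 M : R, 0 <= M & forall x, `|x| <= L -> `|p.[x]| <= M.
Proof.
exists (\sum_(i < size p) `|p`_i| * `|L| ^+ i).
  by apply: sumr_ge0 => i _; rewrite mulr_ge0// exprn_ge0.
move=> x xL; rewrite horner_coef.
apply: (le_trans (ler_norm_sum _ _ _)); apply: ler_sum => i _.
by rewrite normrM normrX ler_wpM2l// lerXn2r// ?nnegrE// (le_trans xL)// ler_norm.
Qed.

Definition bump_poly N : {poly R} := (1 - 'X ^+ 2) ^+ N.

Lemma is_derive_hornerM (p : {poly R}) (c x : R) :
  is_derive x 1 (fun y => p.[c * y]) (c * p^`().[c * x]).
Proof.
have := @is_derive1_comp _ (horner p) _ x _ _ (is_derive_poly _ _)
  (is_derive_mulrl c x).
by move=> /is_derive_eq; apply; rewrite mulrC.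
Qed.

Lemma continuous_hornerM (p : {poly R}) (c : R) : continuous (fun y => p.[c * y]).
Proof. apply: continuous_is_derive => x; exact: is_derive_hornerM. Qed.

Lemma bump_polyS N : bump_poly N.+1 = (1 - 'X ^+ 2) * bump_poly N.
Proof. by rewrite /bump_poly exprS. Qed.

(** Divisibility by [(1 - X^2)^N] encodes vanishing to order [N] at both ends of [[-1, 1]]. A
    derivative costs one order, which makes divisibility a suitable induction hypothesis for
    repeated integration by parts. *)
Lemma dvdp_bump_deriv N (p : {poly R}) :
  (bump_poly N.+1 %| p)%R -> (bump_poly N %| p^`())%R.
Proof.
move=> /Pdiv.Field.dvdpP[q ->]; rewrite derivM dvdp_add//.
  by rewrite bump_polyS mulrA; exact: dvdp_mull.
by rewrite /bump_poly deriv_exp /= mulrnAr mulrA -mulrnAl; apply: dvdp_mull.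
Qed.

(** Induction on [N]: one integration by parts turns [(L s)^2] times the power of [p] into the power
    of [p'] at the same scale [L], the factor [L^-1] from the chain rule being absorbed by [L].
    Hence the constant found for [p'] also serves for [p], and it depends on neither [L] nor [s]. *)
Lemma trig_power_poly_decay N (p : {poly R}) : (bump_poly N %| p)%R ->
  exists2 M : R, 0 <= M & forall L s, 0 < L ->
    trig_power (fun x => p.[L^-1 * x]) (- L) L s * (L * s) ^+ (2 * N) <= M * L ^+ 2.
Proof.
elim: N p => [|N IH] p.
  move=> _; have [M M0 pM] := horner_bounded p 1.
  (* Each of the two moments is at most [2 * M * L] in absolute value: [M] bounds the integrand and
     [2 * L] is the length of the segment. *)
  exists (2 * (2 * M) ^+ 2); first by rewrite mulr_ge0// sqr_ge0.
  move=> L s L0; rewrite mulr1.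
  have key (g : R -> R) : continuous g -> (forall x, `|g x| <= 1) ->
      (\int[mu]_(x in `[- L, L]) (p.[L^-1 * x] * g x)) ^+ 2 <= (2 * M * L) ^+ 2.
    move=> cg g1.
    have cpg : continuous (fun x => p.[L^-1 * x] * g x).
      by apply: continuous_mul => //; exact: continuous_hornerM.
    rewrite -ler_sqrt ?sqr_ge0// !sqrtr_sqr.
    apply: (le_trans (le_normr_Rintegral _ _)) => //.
      exact: continuous_integrable_segment.
    apply: (@le_trans _ _ (\int[mu]_(x in `[- L, L]) M)).
      apply: le_Rintegral => //.
      - apply: continuous_integrable_segment => x.
        by apply: cvg_norm; exact: cpg.
      - by apply: continuous_integrable_segment => x; exact: cvg_cst.
      - move=> x; rewrite /= in_itv/= => xL; rewrite normrM -[leRHS]mulr1.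
        apply: ler_pM => //; apply: pM.
        rewrite normrM (@ger0_norm _ L^-1) ?invr_ge0 ?(ltW L0)// ler_pdivrMl// mulr1.
        by rewrite ler_norml.
    rewrite Rintegral_cst// [X in fine X](lebesgue_measure_itv `[- L, L])/= lte_fin.
    rewrite ifT ?(lt_trans _ L0)// ?oppr_lt0// -EFinB/= opprK.
    by rewrite ger0_norm ?mulr_ge0 ?(ltW L0)//; lra.
  rewrite /trig_power (_ : _ * L ^+ 2 = (2 * M * L) ^+ 2 + (2 * M * L) ^+ 2).
    by apply: lerD; apply: key;
      rewrite ?cos_max ?sin_max//; [exact: continuous_cosM|
      move=> x; exact: cos_max|exact: continuous_sinM|move=> x; exact: sin_max].
  by ring.
move=> dp; have [M M0 HM] := IH _ (dvdp_bump_deriv dp).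
exists M => // L s L0.
have pz x : x ^+ 2 = 1 -> p.[x] = 0.
  move=> x1; have /Pdiv.Field.dvdpP[q ->] := dp.
  by rewrite bump_polyS !hornerM (_ : (1 - 'X ^+ 2).[x] = 0) ?mul0r ?mulr0// !hornerE x1 subrr.
have L1 : L^-1 * L = 1 by rewrite mulVf ?gt_eqF.
have [] := @cosint_sinint_parts (fun x => p.[L^-1 * x])
  (fun x => L^-1 * p^`().[L^-1 * x]) (- L) L s.
- by rewrite (lt_trans _ L0)// oppr_lt0.
- by move=> x; exact: is_derive_hornerM.
- by move=> x; apply: cvgM; [exact: cvg_cst|exact: continuous_hornerM].
- by apply: pz; rewrite mulrN sqrrN L1 expr1n.
- by apply: pz; rewrite L1 expr1n.
have -> : sinint (fun x => L^-1 * p^`().[L^-1 * x]) (- L) L s =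
    L^-1 * sinint (fun x => p^`().[L^-1 * x]) (- L) L s.
  rewrite /sinint -RintegralZl//.
    by apply: eq_Rintegral => x _; rewrite mulrA.
  apply: continuous_integrable_segment; apply: continuous_mul.
    exact: continuous_hornerM.
  exact: continuous_sinM.
have -> : cosint (fun x => L^-1 * p^`().[L^-1 * x]) (- L) L s =
    L^-1 * cosint (fun x => p^`().[L^-1 * x]) (- L) L s.
  rewrite /cosint -RintegralZl//.
    by apply: eq_Rintegral => x _; rewrite mulrA.
  apply: continuous_integrable_segment; apply: continuous_mul.
    exact: continuous_hornerM.
  exact: continuous_cosM.
move=> H1 H2.
apply: le_trans (HM L s L0); rewrite mulnS exprD mulrA ler_wpM2r//.
  by rewrite exprM exprn_ge0 ?sqr_ge0.
rewrite le_eqVlt; apply/orP; left; apply/eqP.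
rewrite /trig_power mulrDl -!exprMn -!(mulrCA L) !(mulrC _ s) H1 H2.
by rewrite mulrN !mulrA divff ?gt_eqF// !mul1r sqrrN addrC.
Qed.

(** The decay of order [N] says nothing near [s = 0]; adding the bound of order 0 replaces [(L s)^2]
    by [1 + (L s)^2]. *)
Lemma trig_power_bump_decay N : exists2 M : R, 0 <= M & forall L s, 0 < L ->
  trig_power (fun x => (bump_poly N).[L^-1 * x]) (- L) L s *
    (1 + (L * s) ^+ 2) ^+ N <= M * L ^+ 2.
Proof.
have [M M0 HM] := @trig_power_poly_decay N (bump_poly N) (dvdpp _).
have [K K0 HK] := @trig_power_poly_decay 0 (bump_poly N) (dvd1p _).
exists (2 ^+ N * (K + M)); first by rewrite mulr_ge0 ?exprn_ge0 ?addr_ge0.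
move=> L s L0; set T := trig_power _ _ _ _.
have T0 : 0 <= T by rewrite addr_ge0 ?sqr_ge0.
have := HM L s L0; have := HK L s L0; rewrite -/T muln0 expr0 exprM.
set z := (L * s) ^+ 2; have z0 : 0 <= z by exact: sqr_ge0.
move=> hK hM.
(* [1 + z] is at most twice the larger of [1] and [z]. *)
have : (1 + z) ^+ N <= 2 ^+ N * (1 + z ^+ N).
  have [z1|z1] := leP z 1.
    apply: (@le_trans _ _ (2 ^+ N)); first by rewrite lerXn2r ?nnegrE//; lra.
    by rewrite ler_peMr ?exprn_ge0// lerDl exprn_ge0.
  apply: (@le_trans _ _ ((2 * z) ^+ N)); first by rewrite lerXn2r ?nnegrE//; lra.
  by rewrite exprMn ler_wpM2l ?exprn_ge0// lerDr.
move=> /(ler_wpM2l T0) /le_trans; apply.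
apply: le_trans (le_trans _ (ler_wpM2l (exprn_ge0 N (ler0n R 2)) (lerD hK hM))) _.
  by rewrite le_eqVlt; apply/orP; left; apply/eqP; ring.
by rewrite le_eqVlt; apply/orP; left; apply/eqP; ring.
Qed.

End trigonometric_moments.

(** * Fubini for products of coordinate functions *)

Section product_functions.
Context {R : realType}.
Local Notation leb := (@lebesgue_measure R).

Definition rV_tail d (x : 'rV[R]_d.+1) : 'rV[R]_d := \row_i x ord0 (lift ord0 i).

Lemma cons_rV_head d (p : measurableTypeR R * 'rV[R]_d) : cons_rV p ord0 ord0 = p.1.
Proof. by rewrite /cons_rV mxE unlift_none. Qed.

Lemma cons_rV_tail d (p : measurableTypeR R * 'rV[R]_d) : rV_tail (cons_rV p) = p.2.
Proof. by apply/rowP => i; rewrite !mxE liftK. Qed.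

Lemma measurable_rV_tail d : measurable_fun setT (@rV_tail d).
Proof.
apply: measurable_fun_rV => i.
rewrite (_ : (fun _ => _) = fun x : 'rV[R]_d.+1 => x ord0 (lift ord0 i)).
  exact: measurable_coord.
by apply/funext => x; rewrite mxE.
Qed.

Section fubini_product.
Context d1 d2 (T1 : measurableType d1) (T2 : measurableType d2).
Variables (m1 : {sigma_finite_measure set T1 -> \bar R})
  (m2 : {sigma_finite_measure set T2 -> \bar R}).
Variables (a : T1 -> R) (b : T2 -> R).
Hypotheses (ia : m1.-integrable setT (EFin \o a))
  (ib : m2.-integrable setT (EFin \o b)).

Lemma integrable_prod_mul :
  (m1 \x m2)%E.-integrable setT (fun p => (a p.1 * b p.2)%:E).
Proof.
have ma : measurable_fun setT a by apply/measurable_EFinP; exact: measurable_int ia.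
have mb : measurable_fun setT b by apply/measurable_EFinP; exact: measurable_int ib.
apply/integrable12ltyP.
  apply/measurable_EFinP; apply: measurable_funM.
    by apply: measurableT_comp => //.
  by apply: measurableT_comp => //.
have -> : (\int[m1]_x \int[m2]_y `|(a (x, y).1 * b (x, y).2)%:E| =
    \int[m1]_x (`|a x|%:E * \int[m2]_y `|(b y)%:E|))%E.
  apply: eq_integral => x _.
  rewrite -ge0_integralZl//.
  - by apply: eq_integral => y _; rewrite /= normrM EFinM.
  - by do 2 apply: measurableT_comp => //.
have [_ ib2] := integrableP _ _ _ ib.
have [_ ia2] := integrableP _ _ _ ia.
have b2 : (\int[m2]_y `|(b y)%:E|)%E \is a fin_num.
  by rewrite ge0_fin_numE// integral_ge0.
rewrite -(fineK b2) ge0_integralZr//.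
- by rewrite lte_mul_pinfty// ?fineK ?integral_ge0// ge0_fin_numE ?integral_ge0.
- by do 2 apply: measurableT_comp => //.
- by rewrite lee_fin fine_ge0 ?integral_ge0.
Qed.

Lemma Rintegral_prod_mul :
  \int[(m1 \x m2)%E]_p (a p.1 * b p.2) = (\int[m1]_x a x) * (\int[m2]_y b y).
Proof.
rewrite /Rintegral -integral12_prod_meas1; last exact: integrable_prod_mul.
have fb : (\int[m2]_y (b y)%:E)%E \is a fin_num by exact: integrable_fin_num.
have fa : (\int[m1]_y (a y)%:E)%E \is a fin_num by exact: integrable_fin_num.
rewrite -fineM//; congr fine.
transitivity (\int[m1]_x ((a x)%:E * (fine (\int[m2]_y (b y)%:E))%:E))%E.
  by apply: eq_integral => x _; rewrite /fubini_F fineK// -integralZl.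
by rewrite integralZr// fineK.
Qed.

End fubini_product.

(** By construction [lebesgue_rV d.+1] is the image of a product measure under [cons_rV], so a
    change of variables reduces this to [integrable_prod_mul]. *)
Lemma integrable_lebesgue_rV_mul d (a : R -> R) (b : 'rV[R]_d -> R) :
  leb.-integrable setT (EFin \o a) -> (lebesgue_rV d).-integrable setT (EFin \o b) ->
  (lebesgue_rV d.+1).-integrable setT (fun x => (a (x ord0 ord0) * b (rV_tail x))%:E).
Proof.
move=> ia ib.
have ma : measurable_fun setT a by apply/measurable_EFinP; exact: measurable_int ia.
have mb : measurable_fun setT b by apply/measurable_EFinP; exact: measurable_int ib.
apply: (@integrable_pushforward _ _ _ _ _ _ (@measurable_cons_rV R d)
  (leb \x lebesgue_rV d)%E) => //.
- apply/measurable_EFinP; apply: measurable_funM.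
    by apply: measurableT_comp => //; exact: measurable_coord.
  by apply: measurableT_comp => //; exact: measurable_rV_tail.
- rewrite preimage_setT; apply: eq_integrable (integrable_prod_mul ia ib) => // p _.
  by rewrite /= cons_rV_head cons_rV_tail.
Qed.

Lemma Rintegral_lebesgue_rV_mul d (a : R -> R) (b : 'rV[R]_d -> R) :
  leb.-integrable setT (EFin \o a) -> (lebesgue_rV d).-integrable setT (EFin \o b) ->
  \int[lebesgue_rV d.+1]_x (a (x ord0 ord0) * b (rV_tail x)) =
  (\int[leb]_x a x) * (\int[lebesgue_rV d]_x b x).
Proof.
move=> ia ib.
have ma : measurable_fun setT a by apply/measurable_EFinP; exact: measurable_int ia.
have mb : measurable_fun setT b by apply/measurable_EFinP; exact: measurable_int ib.
rewrite -Rintegral_prod_mul//; congr fine.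
rewrite (@integral_pushforward _ _ _ _ _ _ (@measurable_cons_rV R d)
  (leb \x lebesgue_rV d)%E) => //.
- by rewrite preimage_setT; apply: eq_integral => p _ /=; rewrite cons_rV_head cons_rV_tail.
- apply/measurable_EFinP; apply: measurable_funM.
    by apply: measurableT_comp => //; exact: measurable_coord.
  by apply: measurableT_comp => //; exact: measurable_rV_tail.
- rewrite preimage_setT; apply: eq_integrable (integrable_prod_mul ia ib) => // p _.
  by rewrite /= cons_rV_head cons_rV_tail.
Qed.

Definition cintegrable disp (T : measurableType disp) (mu : {measure set T -> \bar R})
    (g : T -> R[i]) : Prop :=
  mu.-integrable setT (fun x => (complex.Re (g x))%:E) /\
  mu.-integrable setT (fun x => (complex.Im (g x))%:E).

Lemma ReM (z w : R[i]) :
  complex.Re (z * w) = complex.Re z * complex.Re w - complex.Im z * complex.Im w.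
Proof. by case: z w => [a b] [c e]. Qed.

Lemma ImM (z w : R[i]) :
  complex.Im (z * w) = complex.Re z * complex.Im w + complex.Im z * complex.Re w.
Proof. by case: z w => [a b] [c e] /=; rewrite addrC (mulrC b) addrC. Qed.

(** Induction on the dimension, splitting off the first coordinate. The real and imaginary parts of
    the product of the head and the tail consist of four real products, and Fubini applies to each.
    Integrability is carried along because it is what Fubini asks of the tail. *)
Lemma cintegral_prod_coord d (e : 'I_d -> R -> R[i]) :
  (forall i, cintegrable leb (e i)) ->
  cintegrable (lebesgue_rV d) (fun x => \prod_(i < d) e i (x ord0 i)) /\
  cintegral (lebesgue_rV d) (fun x => \prod_(i < d) e i (x ord0 i)) =
  \prod_(i < d) cintegral leb (e i).
Proof.
elim: d e => [|d IH] e ie.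
  (* In dimension 0 the measure is a unit mass and the empty product is 1. *)
  under eq_fun do rewrite big_ord0.
  rewrite big_ord0; split.
    split => /=; apply/integrableP; split => //.
      rewrite [ltLHS](_ : _ = 1%E) ?ltry//.
      by rewrite integral_dirac//= diracT mul1e normr1.
    rewrite [ltLHS](_ : _ = 0%E) ?ltry//.
    by rewrite integral_dirac//= diracT mul1e normr0.
  rewrite /cintegral /= /Rintegral /= !integral_dirac//= indicT mulr0 mulr1.
  by [].
have [[iR iI] IE] := IH (fun i => e (lift ord0 i)) (fun i => ie _).
set b := (fun x : 'rV[R]_d => \prod_(i < d) e (lift ord0 i) (x ord0 i)) in iR iI IE.
have [aR aI] := ie ord0; set a := e ord0 in aR aI.
have -> : (fun x : 'rV[R]_d.+1 => \prod_(i < d.+1) e i (x ord0 i)) =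
    (fun x => a (x ord0 ord0) * b (rV_tail x)).
  apply/funext => x; rewrite big_ord_recl; congr (_ * _).
  by apply: eq_bigr => i _; rewrite mxE.
rewrite big_ord_recl -IE.
have RR := integrable_lebesgue_rV_mul aR iR.
have RI := integrable_lebesgue_rV_mul aR iI.
have IR := integrable_lebesgue_rV_mul aI iR.
have II := integrable_lebesgue_rV_mul aI iI.
split.
  split.
    apply: eq_integrable (integrableB _ RR II) => // x _.
    by rewrite /= ReM.
  apply: eq_integrable (integrableD _ RI IR) => // x _.
  by rewrite /= ImM.
have mulcE (z w : R[i]) : z * w =
    ((complex.Re z * complex.Re w - complex.Im z * complex.Im w) +i*
     (complex.Re z * complex.Im w + complex.Im z * complex.Re w))%C.
  by rewrite -ReM -ImM; case: (z * w).
rewrite mulcE {mulcE}.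
rewrite /cintegral /= -!Rintegral_lebesgue_rV_mul//.
congr (_ +i* _)%C.
  rewrite -RintegralB//; apply: eq_Rintegral => x _; exact: ReM.
rewrite -RintegralD//; apply: eq_Rintegral => x _; exact: ImM.
Qed.

End product_functions.

(** * Product test functions *)

Section box_functions.
Context {R : realType}.
Local Notation leb := (@lebesgue_measure R).
Implicit Types (u : R -> R) (a b t : R).

Lemma cexp0 : cexp 0 = 1 :> R[i].
Proof. by rewrite /cexp cos0 sin0. Qed.

Lemma cexpD (s t : R) : cexp (s + t) = cexp s * cexp t.
Proof. by rewrite /cexp cosD sinD; apply/eqP; rewrite eq_complex/= eqxx/= addrC. Qed.

Lemma sqr_normcM (z w : R[i]) : sqr_normc (z * w) = sqr_normc z * sqr_normc w.
Proof. by rewrite /sqr_normc ReM ImM; ring. Qed.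

Lemma sqr_normc_ge0 (z : R[i]) : 0 <= sqr_normc z.
Proof. by rewrite addr_ge0 ?sqr_ge0. Qed.

Lemma sqr_normc_prod (I : Type) (r : seq I) (F : I -> R[i]) :
  sqr_normc (\prod_(i <- r) F i) = \prod_(i <- r) sqr_normc (F i).
Proof.
apply: (big_morph _ sqr_normcM).
by rewrite /sqr_normc /= expr1n expr0n addr0.
Qed.

Lemma bounded_set_coord d (A : set 'rV[R]_d) (L : R) :
  (forall x i, A x -> `|x ord0 i| <= L) -> bounded_set A.
Proof.
move=> AL; exists `|L|; split; first exact: num_real.
move=> M LM x Ax /=.
have M0 : 0 <= M by rewrite (le_trans _ (ltW LM)).
rewrite [leLHS]mx_normrE; apply: bigmax_le => // -[i j] _ /=.
by rewrite (ord1 i) (le_trans (AL _ _ Ax))// (le_trans (ler_norm _))// ltW.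
Qed.

Definition window u a b : R -> R := u \_ `[a, b].

Lemma windowE u a b x : window u a b x = if a <= x <= b then u x else 0.
Proof.
by rewrite /window patchE mem_setE in_itv.
Qed.

Lemma measurable_window u a b : continuous u -> measurable_fun setT (window u a b).
Proof.
move=> cu; have mu : measurable_fun setT u by apply: continuous_measurable_fun; exact: cu.
apply: (proj1 (@measurable_restrictT _ _ _ _ `[a, b] u _)) => //.
exact: measurable_funTS.
Qed.

Lemma window_bounded u a b : continuous u ->
  exists2 M : R, 0 <= M & forall x, `|window u a b x| <= M.
Proof.
move=> cu; have [ab|ba] := leP a b; last first.
  exists 0 => // x; rewrite windowE; case: ifPn => [|]; rewrite ?normr0//.
  by move=> /andP[ax xb]; have := le_trans ax xb; rewrite leNgt ba.
have cn : {within `[a, b], continuous (fun x => `|u x|)}.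
  by apply: continuous_subspaceT => x; apply: cvg_norm; exact: cu.
have [c _ cM] := EVT_max ab cn.
exists `|u c| => // x; rewrite windowE; case: ifPn => [|]; rewrite ?normr0//.
by move=> xab; apply: cM; rewrite in_itv.
Qed.

Lemma windowM u v a b x : window u a b x * v x = window (fun y => u y * v y) a b x.
Proof. by rewrite !windowE; case: ifP => //; rewrite mul0r. Qed.

(** The minus sign in the exponent only changes the sign of the sine moment, which the square
    forgets. *)
Lemma window_trig_power u a b t : continuous u ->
  cintegrable leb (fun x => (window u a b x)%:C%C * cexp (- (2 * pi * (x * t)))) /\
  sqr_normc (cintegral leb (fun x => (window u a b x)%:C%C * cexp (- (2 * pi * (x * t))))) =
  trig_power u a b (2 * pi * t).
Proof.
move=> cu; set s := 2 * pi * t.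
have sE x : 2 * pi * (x * t) = s * x by rewrite /s; ring.
have ReE x : complex.Re ((window u a b x)%:C%C * cexp (- (2 * pi * (x * t)))) =
    window (fun y => u y * cos (s * y)) a b x.
  rewrite ReM /= mul0r subr0 cosN sE.
  exact: (windowM u (fun y => cos (s * y))).
have ImE x : complex.Im ((window u a b x)%:C%C * cexp (- (2 * pi * (x * t)))) =
    window (fun y => - 1 * (u y * sin (s * y))) a b x.
  rewrite ImM /= mul0r addr0 sinN sE.
  rewrite (_ : (fun y => _) = (fun y => u y * - sin (s * y))).
    exact: (windowM u (fun y => - sin (s * y))).
  by apply/funext => y; rewrite mulN1r mulrN.
have i1 : leb.-integrable `[a, b] (EFin \o (fun y => u y * cos (s * y))).
  apply: continuous_integrable_segment; apply: continuous_mul => //.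
  exact: continuous_cosM.
have i2 : leb.-integrable `[a, b] (EFin \o (fun y => u y * sin (s * y))).
  apply: continuous_integrable_segment; apply: continuous_mul => //.
  exact: continuous_sinM.
have i3 : leb.-integrable `[a, b] (EFin \o (fun y => - 1 * (u y * sin (s * y)))).
  apply: continuous_integrable_segment; apply: continuous_mull; apply: continuous_mul => //.
  exact: continuous_sinM.
have wE f : (fun x => (window f a b x)%:E) = (EFin \o f) \_ `[a, b].
  by rewrite restrict_EFin.
split; first split.
- under eq_fun do rewrite ReE.
  by rewrite wE; apply: (proj1 (@integrable_mkcond _ _ R leb `[a, b] _ _)).
- under eq_fun do rewrite ImE.
  by rewrite wE; apply: (proj1 (@integrable_mkcond _ _ R leb `[a, b] _ _)).
rewrite /sqr_normc /cintegral /=.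
rewrite /trig_power -(sqrrN (sinint _ _ _ _)); congr (_ ^+ 2 + _ ^+ 2).
  by rewrite /cosint Rintegral_mkcond; apply: eq_Rintegral => x _; exact: ReE.
rewrite /sinint -mulN1r -RintegralZl// Rintegral_mkcond.
by apply: eq_Rintegral => x _; exact: ImE.
Qed.

Definition box_fun d u a b (x : 'rV[R]_d) : R := \prod_(i < d) window u a b (x ord0 i).

(** The character [e^(-2 pi i <x, xi>)] is a product over the coordinates, so the integral factors
    into one-dimensional ones. *)
Lemma fourier_box_fun d u a b (xi : 'rV[R]_d) : continuous u ->
  sqr_normc (fourier (fun x => (box_fun u a b x)%:C%C) xi) =
  \prod_(i < d) trig_power u a b (2 * pi * xi ord0 i).
Proof.
move=> cu; pose e (i : 'I_d) (x : R) :=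
  (window u a b x)%:C%C * cexp (- (2 * pi * (x * xi ord0 i))).
have [_ E] := cintegral_prod_coord (fun i => (window_trig_power a b (xi ord0 i) cu).1).
have -> : fourier (fun x => (box_fun u a b x)%:C%C) xi =
    cintegral (lebesgue_rV d) (fun x => \prod_(i < d) e i (x ord0 i)).
  rewrite /fourier; congr cintegral; apply/funext => x.
  rewrite /e big_split/=; congr (_ * _).
    by rewrite /box_fun rmorph_prod.
  rewrite /inner mulr_sumr -sumrN.
  by apply: (big_morph _ cexpD cexp0).
rewrite E sqr_normc_prod; apply: eq_bigr => i _.
by rewrite (window_trig_power _ _ _ _).2.
Qed.

Lemma measurable_box_fun d u a b : continuous u ->
  measurable_fun setT (box_fun u a b : 'rV[R]_d -> R).
Proof.
move=> cu; apply: measurable_prod => i _.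
by apply: measurableT_comp; [exact: measurable_window|exact: measurable_coord].
Qed.

Lemma box_fun_bounded d u a b : continuous u ->
  exists2 M : R, 0 <= M & forall x : 'rV[R]_d, `|box_fun u a b x| <= M.
Proof.
move=> cu; have [M M0 uM] := window_bounded a b cu.
exists (M ^+ d); first exact: exprn_ge0.
move=> x; rewrite /box_fun normr_prod.
rewrite -[d in M ^+ d]card_ord -prodr_const; apply: ler_prod => i _.
by rewrite normr_ge0 uM.
Qed.

Lemma box_fun_support d u a b (x : 'rV[R]_d) :
  box_fun u a b x != 0 -> forall i, a <= x ord0 i <= b.
Proof.
move=> /prodf_neq0 H i; have := H i isT.
by rewrite windowE; case: ifPn => //; rewrite eqxx.
Qed.

Lemma test_function_box_fun d u a b : continuous u ->
  test_function (fun x : 'rV[R]_d => (box_fun u a b x)%:C%C).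
Proof.
move=> cu; split.
- by split => //=; exact: measurable_box_fun.
- have [M M0 uM] := @box_fun_bounded d u a b cu.
  exists (M ^+ 2) => x; rewrite /sqr_normc /= expr0n addr0.
  by rewrite -real_normK ?num_real// lerXn2r// nnegrE.
- apply: (@bounded_set_coord _ _ (`|a| + `|b|)) => x i /= fx.
  have /(_ i) : forall i, a <= x ord0 i <= b.
    apply: (@box_fun_support _ u); apply: contra fx => /eqP ->.
    by [].
  move=> /andP[ax xb]; rewrite ler_norml; apply/andP; split.
    by have := lerNnormlW (lexx `|a|); have := normr_ge0 b; lra.
  by have := ler_norm b; have := normr_ge0 a; lra.
Qed.

End box_functions.

(** * The integrable weight *)

Section weight.
Context {R : realType} {d : nat}.
Implicit Types (xi : 'rV[R]_d) (L e : R).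

Definition weight xi : R := (\prod_(i < d) (1 + (2 * pi * xi ord0 i) ^+ 2))^-1.

(** Used to compare the product of one-dimensional factors with the Euclidean norm, which defines
    the balls [eball]. *)
Lemma prod1D_ge (I : Type) (r : seq I) (f : I -> R) : (forall i, 0 <= f i) ->
  1 + \sum_(i <- r) f i <= \prod_(i <- r) (1 + f i).
Proof.
move=> f0; elim: r => [|i r IH]; first by rewrite !big_nil addr0.
rewrite !big_cons; apply: le_trans (ler_wpM2l _ IH); last first.
  by rewrite addr_ge0.
have : 0 <= \sum_(j <- r) f j by apply: sumr_ge0.
by have := f0 i; nra.
Qed.

Lemma weight_ge0 xi : 0 <= weight xi.
Proof. by rewrite invr_ge0 prodr_ge0// => i _; rewrite addr_ge0// sqr_ge0. Qed.

Lemma measurable_weight : measurable_fun setT weight.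
Proof.
rewrite (_ : weight = fun xi => \prod_(i < d) (1 + (2 * pi * xi ord0 i) ^+ 2)^-1); last first.
  by apply/funext => xi; rewrite /weight prodfV.
apply: measurable_prod => i _.
apply: (@measurableT_comp _ _ _ _ _ _ (fun t : R => (1 + (2 * pi * t) ^+ 2)^-1)); last first.
  exact: measurable_coord.
apply: continuous_measurable_fun => t; apply: cvgV.
  by rewrite gt_eqF// ltr_pwDl// sqr_ge0.
apply: cvgD; first exact: cvg_cst.
apply: (@continuous_comp _ _ _ _ (fun x : R => x ^+ 2)).
  by apply: cvgM; [exact: cvg_cst|exact: cvg_id].
exact: exprn_continuous.
Qed.

Lemma measurable_eball e : measurable (eball e : set 'rV[R]_d).
Proof.
have -> : eball e = (fun x : 'rV[R]_d => Num.sqrt (inner x x)) @^-1` `]-oo, e[.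
  by apply/seteqP; split => x /=; rewrite in_itv.
rewrite -[X in measurable X]setTI.
apply: (@measurableT_comp _ _ _ _ _ _ (@Num.sqrt R)) => //.
  by apply: continuous_measurable_fun => t; exact: sqrt_continuous.
apply: measurable_sum => i.
by apply: measurable_funM; exact: measurable_coord.
Qed.

Lemma weight_le_fourier_expN xi :
  ((1 - (expR 1)^-1) ^+ 2) ^+ d * weight xi <=
  sqr_normc (fourier (fun x : 'rV[R]_d => (box_fun (fun t => expR (- t)) 0 1 x)%:C%C) xi).
Proof.
rewrite fourier_box_fun; last first.
  by move=> x; apply: continuous_comp; [exact: opp_continuous|exact: continuous_expR].
rewrite /weight -prodfV -[d in X in X * _]card_ord -prodr_const -big_split/=.
apply: ler_prod => i _; rewrite trig_power_expN andbT.
by rewrite mulr_ge0 ?sqr_ge0// invr_ge0 addr_ge0// sqr_ge0.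
Qed.

(** A single test function, the truncated exponential, controls [etahat] at infinity: its squared
    transform is integrable and dominates a positive multiple [c] of the weight, with [c > 0]
    because [e > 1]. *)
Lemma integrable_weight (etahat : {measure set 'rV[R]_d -> \bar R}) :
  (forall f, test_function f ->
    etahat.-integrable setT (fun xi => (sqr_normc (fourier f xi))%:E)) ->
  etahat.-integrable setT (EFin \o weight).
Proof.
move=> H; set c : R := ((1 - (expR 1)^-1) ^+ 2) ^+ d.
have c0 : 0 < c.
  rewrite exprn_gt0// exprn_gt0// subr_gt0 invf_lt1 ?expR_gt0//.
  by rewrite expR_gt1.
have tf : test_function (fun x : 'rV[R]_d => (box_fun (fun t => expR (- t)) 0 1 x)%:C%C).
  apply: test_function_box_fun.
  by move=> x; apply: continuous_comp; [exact: opp_continuous|exact: continuous_expR].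
apply: le_integrable (integrableZl measurableT c^-1 (H _ tf)) => //.
  by apply/measurable_EFinP; exact: measurable_weight.
move=> xi _; rewrite /= lee_fin ger0_norm ?weight_ge0//.
rewrite ger0_norm ?mulr_ge0 ?sqr_normc_ge0 ?invr_ge0 ?(ltW c0)//.
by rewrite mulrC ler_pdivlMr// mulrC weight_le_fourier_expN.
Qed.

Definition bump_fun N L : 'rV[R]_d -> R[i] := fun x =>
  (box_fun (fun t => (bump_poly N).[L^-1 * t]) (- L) L x)%:C%C.

Lemma test_function_bump_fun N L : test_function (bump_fun N L).
Proof. by apply: test_function_box_fun; exact: continuous_hornerM. Qed.

(** Of the [N.+1] powers of decay, [N] yield the small factor outside the ball and the last one is
    kept as the integrable weight. Inside the ball only the size [(M * L^2)^d] is used. *)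
Lemma fourier_bump_fun_bound N : exists2 M : R, 0 <= M & forall L e xi, 1 <= L -> 0 < e ->
  sqr_normc (fourier (bump_fun N.+1 L) xi) <=
  (M * L ^+ 2) ^+ d * (\1_(eball e) xi + ((2 * pi * L * e) ^+ 2) ^- N * weight xi).
Proof.
have [M M0 HM] := @trig_power_bump_decay R N.+1.
exists M => // L e xi L1 e0; have L0 : 0 < L by rewrite (lt_le_trans _ L1).
rewrite fourier_box_fun; last exact: continuous_hornerM.
pose T (i : 'I_d) := trig_power (fun t => (bump_poly N.+1).[L^-1 * t]) (- L) L
  (2 * pi * xi ord0 i).
rewrite (eq_bigr T)//.
pose z (i : 'I_d) := 1 + (L * (2 * pi * xi ord0 i)) ^+ 2.
have z1 i : 1 <= z i by rewrite lerDl sqr_ge0.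
have z0 i : 0 < z i by rewrite (lt_le_trans _ (z1 i)).
have T0 i : 0 <= T i by rewrite addr_ge0 ?sqr_ge0.
have ML : 0 <= M * L ^+ 2 by rewrite mulr_ge0 ?sqr_ge0.
have TM i : T i <= M * L ^+ 2 * (z i)^-1 ^+ N.+1.
  by rewrite exprVn ler_pdivlMr ?exprn_gt0//; exact: HM.
have -> : (M * L ^+ 2) ^+ d = \prod_(i < d) (M * L ^+ 2) by rewrite prodr_const card_ord.
rewrite indicE; case: (boolP (xi \in eball e)) => [_|].
  rewrite mulrDr mulr1; apply: (@le_trans _ _ (\prod_(i < d) (M * L ^+ 2))).
    apply: ler_prod => i _; rewrite T0/= (le_trans (TM i))//.
    by rewrite ler_piMr// exprn_ile1 ?invr_ge0 ?(ltW (z0 i))// invf_le1.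
  rewrite lerDl mulr_ge0//; first by apply: prodr_ge0.
  by rewrite mulr_ge0 ?weight_ge0// invr_ge0 exprn_ge0// sqr_ge0.
rewrite notin_setE /eball /= => /negP; rewrite -leNgt add0r => xie.
apply: (@le_trans _ _ (\prod_(i < d) (M * L ^+ 2 * (z i)^-1 ^+ N.+1))).
  by apply: ler_prod => i _; rewrite T0/=.
rewrite big_split/= ler_wpM2l ?prodr_ge0//.
rewrite prodrXl prodfV exprS mulrC.
have pz0 : 0 < \prod_(i < d) z i by apply: prodr_gt0.
apply: ler_pM; rewrite ?exprn_ge0 ?invr_ge0 ?(ltW pz0)//.
  (* Outside the ball the product of the [z i] is at least [1 + (2 pi L)^2 |xi|^2], hence at least
     [(2 pi L e)^2]. *)
  have e20 : 0 < (2 * pi * L * e) ^+ 2 by rewrite exprn_gt0// !mulr_gt0// pi_gt0.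
  rewrite -exprVn lerXn2r ?nnegrE ?invr_ge0 ?(ltW pz0) ?(ltW e20)//.
  rewrite lef_pV2 ?posrE//.
  apply: (@le_trans _ _ (1 + \sum_(i < d) (L * (2 * pi * xi ord0 i)) ^+ 2)); last first.
    by apply: prod1D_ge => i; exact: sqr_ge0.
  rewrite (eq_bigr (fun i : 'I_d => (2 * pi * L) ^+ 2 * (xi ord0 i * xi ord0 i))); last first.
    by move=> i _; ring.
  rewrite -mulr_sumr -/(inner xi xi).
  rewrite exprMn (@le_trans _ _ ((2 * pi * L) ^+ 2 * inner xi xi))//; last by rewrite lerDr.
  rewrite ler_wpM2l ?sqr_ge0//.
  have in0 : 0 <= inner xi xi by apply: sumr_ge0 => i _; rewrite -expr2 sqr_ge0.
  by rewrite -[leRHS]sqr_sqrtr// lerXn2r ?nnegrE ?sqrtr_ge0 ?(ltW e0).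
(* As [L >= 1], each [z i] is at least the corresponding factor of the weight, which does not
   involve [L]. *)
rewrite /weight lef_pV2 ?posrE//; last first.
  by apply: prodr_gt0 => i _; rewrite ltr_pwDl// sqr_ge0.
apply: ler_prod => i _; rewrite addr_ge0 ?sqr_ge0//= lerD2l [leRHS]exprMn.
by rewrite ler_peMl ?sqr_ge0// exprn_ege1.
Qed.

End weight.

(** * Vanishing of the diffraction integrals *)

Section asymptotics.
Context {R : realType} {d : nat}.
Variables (etahat : {measure set 'rV[R]_d -> \bar R}).
Hypothesis etahat_int : forall f, test_function f ->
  etahat.-integrable setT (fun xi => (sqr_normc (fourier f xi))%:E).

(** Integrates the pointwise bound, with [W] the integral of the weight. [M] and [W] are fixed
    before [L] and [e], so that both may later vary with [n]. *)
Lemma Rintegral_fourier_bump_fun_le N : exists2 M : R, 0 <= M & exists2 W : R, 0 <= W &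
  forall L e : R, 1 <= L -> 0 < e -> (etahat (eball e) < +oo)%E ->
  \int[etahat]_xi sqr_normc (fourier (bump_fun N.+1 L) xi) <=
  (M * L ^+ 2) ^+ d * (fine (etahat (eball e)) + ((2 * pi * L * e) ^+ 2) ^- N * W).
Proof.
have [M M0 HM] := @fourier_bump_fun_bound R d N.
have iw := integrable_weight etahat_int.
exists M => //; exists (\int[etahat]_xi weight xi).
  by apply: Rintegral_ge0 => xi _; exact: weight_ge0.
move=> L e L1 e0 eoo.
set c := ((2 * pi * L * e) ^+ 2) ^- N; set K := (M * L ^+ 2) ^+ d.
have mB : measurable (eball e : set 'rV[R]_d) by exact: measurable_eball.
have i1 : etahat.-integrable setT (EFin \o \1_(eball e)).
  apply/integrableP; split; first exact/measurable_EFinP.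
  under eq_integral do rewrite /= ger0_norm//.
  by rewrite integral_indic// setIT.
have i2 : etahat.-integrable setT (EFin \o (fun xi => c * weight xi)).
  exact: (integrableZl measurableT c iw).
have i3 : etahat.-integrable setT
    (EFin \o (fun xi => \1_(eball e) xi + c * weight xi)).
  exact: (integrableD measurableT i1 i2).
have i4 : etahat.-integrable setT
    (EFin \o (fun xi => K * (\1_(eball e) xi + c * weight xi))).
  exact: (integrableZl measurableT K i3).
apply: le_trans.
  apply: (@le_Rintegral _ _ _ _ _ _ (fun xi => K * (\1_(eball e) xi + c * weight xi))) => //.
    exact: etahat_int (test_function_bump_fun _ _).
  by move=> xi _; exact: HM.
rewrite RintegralZl// RintegralD// RintegralZl//.
rewrite [X in K * (X + _)](_ : _ = fine (etahat (eball e)))//.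
by rewrite /Rintegral integral_indic// setIT.
Qed.

Lemma diffraction_bump_cvg0 (delta C : R) (eps : nat -> R) :
  0 < delta -> (forall n, 0 < eps n) -> eps n @[n --> \oo] --> (0 : R) ->
  (forall n, (etahat (eball (eps n)) <= (C * eps n `^ (2 * d%:R + delta))%:E)%E) ->
  exists N (L : nat -> R), [/\ forall n, 0 < L n, (L n)^-1 @[n --> \oo] --> 0 &
    \int[etahat]_xi sqr_normc (fourier (bump_fun N (L n)) xi) @[n --> \oo] --> 0].
Proof.
move=> delta0 eps0 epscvg HC.
(* Positivity of [eps] upgrades the limit to one from the right, where real powers with positive
   exponent tend to 0. *)
have epsr : eps n @[n --> \oo] --> 0^'+.
  move=> A A0; have H : \forall n \near \oo, 0 < eps n -> A (eps n) by exact: epscvg _ A0.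
  have {}H : \forall n \near \oo, A (eps n) by apply: filterS H => n; apply.
  exact: H.
have powcvg (r : R) : 0 < r -> eps n `^ r @[n --> \oo] --> 0.
  by move=> r0; apply: cvg_comp epsr (powR_cvg0 r0).
(* This gives [2 d k < delta]; the summand 4 keeps the denominator positive when [d = 0]. *)
pose k := delta / (4 * d%:R + 4).
have d0 : (0 : R) <= d%:R by [].
have k0 : 0 < k by rewrite divr_gt0//; lra.
(* By the Archimedean property, [N] exceeds [d (1 + k) / k]. *)
pose N := Num.bound ((2 * d%:R * (1 + k)) / (2 * k)).
have HN : 2 * d%:R * (1 + k) < 2 * k * N%:R.
  rewrite [ltRHS]mulrC -ltr_pdivrMr ?mulr_gt0//.
  apply: archi_boundP.
  by rewrite divr_ge0 ?mulr_ge0//; lra.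
have [M M0 [W W0 HM]] := Rintegral_fourier_bump_fun_le N.
pose L n := eps n `^ (- (1 + k)).
have L0 n : 0 < L n by rewrite powR_gt0.
(* Up to constants, the ball contributes [eps n `^ a] and its complement
   [eps n `^ b]; the choices of [k] and [N] make both exponents positive. *)
pose a := delta - 2 * d%:R * k.
pose b := 2 * k * N%:R - 2 * d%:R * (1 + k).
have a0 : 0 < a.
  rewrite /a subr_gt0 /k mulrA ltr_pdivrMr; last by lra.
  by nra.
have b0 : 0 < b by rewrite subr_gt0.
exists N.+1, L; split => //.
  rewrite (_ : (fun n => _) = fun n => eps n `^ (1 + k)).
    by apply: powcvg; lra.
  by apply/funext => n; rewrite /L powRN invrK.
pose V n := M ^+ d * (C * eps n `^ a + ((2 * pi) ^+ 2) ^- N * W * eps n `^ b).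
apply: (@squeeze_cvgr _ _ _ _ (fun=> 0) V).
(* The integral bound needs [L n >= 1], which is ensured once [eps n < 1]. *)
- have : \forall n \near \oo, eps n < 1.
    by apply: (cvgr_lt (0 : R)).
  apply: filterS => n e1; apply/andP; split.
    by apply: Rintegral_ge0 => xi _; exact: sqr_normc_ge0.
  have e0 := eps0 n; have enz : eps n != 0 by rewrite gt_eqF.
  have L1 : 1 <= L n.
    rewrite /L powRN invf_ge1 ?powR_gt0//.
    rewrite [leRHS](_ : _ = 1 `^ (1 + k)); last by rewrite powR1.
    by apply: ge0_ler_powR; rewrite ?nnegrE ?(ltW e0) ?(ltW e1)//; lra.
  apply: le_trans (HM _ _ L1 e0 (le_lt_trans (HC n) (ltry _))) _.
  rewrite (exprMn _ M) -(mulrA (M ^+ d)) /V; apply: ler_wpM2l; first exact: exprn_ge0.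
  have L2d : (L n ^+ 2) ^+ d = eps n `^ (- (2 * d%:R * (1 + k))).
    rewrite -exprM -powR_mulrn ?(ltW (L0 n))// /L -powRrM natrM; congr (_ `^ _); ring.
  rewrite mulrDr lerD//.
    rewrite L2d; apply: (@le_trans _ _
      (eps n `^ (- (2 * d%:R * (1 + k))) * (C * eps n `^ (2 * d%:R + delta)))).
      rewrite ler_wpM2l ?powR_ge0//.
      rewrite -lee_fin fineK//.
      by rewrite ge0_fin_numE// (le_lt_trans (HC n) (ltry _)).
    rewrite mulrCA -powRD; last by rewrite enz implybT.
    by rewrite le_eqVlt; apply/orP; left; apply/eqP; congr (C * _ `^ _); rewrite /a; ring.
  rewrite le_eqVlt; apply/orP; left; apply/eqP.
  rewrite L2d -(mulrA (2 * pi)) (exprMn _ (2 * pi)) exprMn invfM.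
  have -> : (((L n * eps n) ^+ 2) ^+ N)^-1 = eps n `^ (2 * k * N%:R).
    rewrite -exprM -powR_mulrn ?mulr_ge0 ?(ltW (L0 n)) ?(ltW e0)//.
    rewrite -powRN /L -[X in _ * X]powRr1 ?(ltW e0)// -powRD; last by rewrite enz implybT.
    by rewrite -powRrM natrM; congr (_ `^ _); ring.
  have -> : eps n `^ b =
      eps n `^ (- (2 * d%:R * (1 + k))) * eps n `^ (2 * k * N%:R).
    by rewrite -powRD ?enz ?implybT// /b addrC.
  by rewrite mulrC -!mulrA; congr (_ * _); rewrite mulrC -mulrA; congr (_ * _); rewrite mulrC.
- exact: cvg_cst.
- rewrite (_ : 0 = M ^+ d * (C * 0 + ((2 * pi) ^+ 2) ^- N * W * 0)); last by ring.
  apply: cvgM; first exact: cvg_cst.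
  by apply: cvgD; (apply: cvgM; [exact: cvg_cst|exact: powcvg]).
Qed.

End asymptotics.

(** * Almost sure convergence along a subsequence *)

Section subsequence.
Context {R : realType} d (T : measurableType d) (P : {measure set T -> \bar R}).

(** Choose [phi k] so that the integrals are at most [2^-(k+1)]. The series of the [Y (phi k)] then
    has a finite integral, hence converges almost everywhere, and its terms tend to 0. Monotonicity
    of [phi] is not asked for: [k <= phi k] already forces it to infinity. *)
Lemma L1_cvg_subseq_ae (Y : nat -> T -> R) :
  (forall n, P.-integrable setT (EFin \o Y n)) -> (forall n w, 0 <= Y n w) ->
  \int[P]_w Y n w @[n --> \oo] --> 0 ->
  exists phi : nat -> nat, (forall k, (k <= phi k)%N) /\
    {ae P, forall w, Y (phi k) w @[k --> \oo] --> 0}.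
Proof.
move=> iY Y0 Ycvg.
have H k : exists n, (k <= n)%N /\ \int[P]_w Y n w <= 1 / (2 ^ k.+1)%:R.
  have e0 : (0 : R) < 1 / (2 ^ k.+1)%:R by rewrite divr_gt0// ltr0n expn_gt0.
  have [N _ HN] := cvgr_le (0 : R) Ycvg _ e0.
  exists (maxn k N); split; first exact: leq_maxl.
  by apply: HN; rewrite /= leq_maxr.
have [phi Hphi] := choice H.
exists phi; split; first by move=> k; have [] := Hphi k.
have mY n : measurable_fun setT (EFin \o Y n) by exact: measurable_int (iY n).
have S0 w : (0 <= \sum_(0 <= k <oo) (Y (phi k) w)%:E)%E.
  by apply: nneseries_ge0 => k _ _; rewrite lee_fin.
have mS : measurable_fun setT (fun w => \sum_(0 <= k <oo) (Y (phi k) w)%:E)%E.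
  apply: ge0_emeasurable_sum => [k w _ _|k _]; first by rewrite lee_fin.
  exact: mY.
have iS : P.-integrable setT (fun w => \sum_(0 <= k <oo) (Y (phi k) w)%:E)%E.
  apply/integrableP; split => //.
  under eq_integral do rewrite gee0_abs//.
  rewrite integral_nneseries//; first last.
  - by move=> k w _; rewrite lee_fin.
  - by move=> k; exact: mY.
  apply: (@le_lt_trans _ _ (1%E : \bar R)); last exact: ltry.
  apply: le_trans (epsilon_trick0 xpredT (ler01 : 0 <= (1 : R))).
  apply: lee_nneseries => [k _ _|k _].
    by apply: integral_ge0 => w _; rewrite lee_fin.
  have [_ hk] := Hphi k.
  have fk := integrable_fin_num measurableT (iY (phi k)).
  by rewrite -(fineK fk) lee_fin.
apply: filterS (integrable_ae measurableT iS) => w /(_ I) Sfin.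
(* Each term is squeezed between 0 and the tail of the series starting at it. *)
have tail : (\sum_(N <= k <oo) (Y (phi k) w)%:E)%E @[N --> \oo] --> (0%E : \bar R).
  apply: nneseries_tail_cvg; first by rewrite -ge0_fin_numE.
  by move=> k _; rewrite lee_fin.
have : (Y (phi k) w)%:E @[k --> \oo] --> (0%:E : \bar R).
  apply: (squeeze_cvge _ (cvg_cst 0%E) tail).
  apply: nearW => k; rewrite lee_fin Y0/=.
  apply: le_trans (@nneseries_lim_ge _ _ xpredT k k.+1 _); first by rewrite big_nat1.
  by move=> n _ _; rewrite lee_fin.
by move=> /fine_cvg.
Qed.

End subsequence.

(** * Linear statistics *)

Section counting.
Import HBNNSimple.
Context {R : realType} {d : nat} {disp : measure_display}
  {Omega : measurableType disp}.
Variables (P : probability Omega R) (Lambda : Omega -> set 'rV[R]_d).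
Hypothesis finiteL : forall w (B : set 'rV[R]_d), bounded_set B ->
  finite_set (Lambda w `&` B).
Hypothesis measurableN : forall B : set 'rV[R]_d, measurable B -> bounded_set B ->
  measurable_fun setT (fun w => npoints (Lambda w `&` B)).

Lemma fsum_indic_npoints (A C : set 'rV[R]_d) : finite_set A ->
  \sum_(x \in A) (\1_C x : R) = (npoints (A `&` C))%:R.
Proof.
move=> fA; have fAC : finite_set (A `&` C) by exact: sub_finite_set fA.
transitivity (\sum_(x \in A `&` C) (1 : R)).
  rewrite fsbig_mkcondr; apply: eq_fsbigr => x _.
  by rewrite indicE; case: ifP.
by rewrite fsbig_finite// big_const_seq count_predT iter_addr addr0.
Qed.

(** Restricting to a bounded [B] makes the sum finite for every function [g], such as the simple
    functions approximating a given one. *)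
Definition counting_sum (B : set 'rV[R]_d) (g : 'rV[R]_d -> R) (w : Omega) : R :=
  \sum_(x \in Lambda w `&` B) g x.

(** For a simple function the sum is a finite combination of the numbers of points in its level sets
    within [B], which are measurable by hypothesis. The general case is a pointwise limit, since
    only finitely many points of each configuration lie in [B]. *)
Lemma measurable_counting_sum (B : set 'rV[R]_d) (g : 'rV[R]_d -> R) :
  measurable B -> bounded_set B -> measurable_fun setT g -> (forall x, 0 <= g x) ->
  measurable_fun setT (counting_sum B g).
Proof.
move=> mB bB mg g0.
have mEg : measurable_fun setT (EFin \o g) by exact/measurable_EFinP.
pose h := nnsfun_approx measurableT mEg.
apply: (@measurable_fun_cvg _ _ _ _ (fun n => counting_sum B (h n))); last first.
  move=> w _; rewrite /counting_sum; have fA := finiteL w bB.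
  rewrite fsbig_finite// (_ : (fun n => _) =
    (fun n => \sum_(x <- fset_set (Lambda w `&` B)) h n x)); last first.
    by apply/funext => n; rewrite fsbig_finite.
  apply: cvg_big => [|x _]; first exact: add_continuous.
  have g0' : forall x, setT x -> (0 <= (EFin \o g) x)%E by move=> y _; rewrite lee_fin.
  by have /fine_cvg := cvg_nnsfun_approx measurableT mEg g0' (I : setT x).
move=> n.
have fr : finite_set (range (h n)) by exact: fimfunP.
rewrite (_ : counting_sum B (h n) = fun w => \sum_(y <- fset_set (range (h n)))
    (y * (npoints (Lambda w `&` (B `&` (h n @^-1` [set y]))))%:R)).
  apply: measurable_sum => y; apply: measurable_funM => //.
  apply: (@measurableT_comp _ _ _ _ _ _ (fun n : nat => n%:R : R)) => //.
  apply: measurableN.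
    by apply: measurableI => //; exact: measurable_sfunP.
  have [L [Lr BL]] := bB; exists L; split=> // r Lr' x [Bx _]; exact: (BL r Lr').
apply/funext => w; rewrite /counting_sum.
under eq_fsbigr do rewrite fimfunE.
rewrite exchange_fsbig//; last exact: (finiteL w bB).
rewrite fsbig_finite//; apply: eq_bigr => y _.
by rewrite -mulr_fsumr fsum_indic_npoints ?setIA//; exact: (finiteL w bB).
Qed.

Lemma linear_statistic_counting_sum (B : set 'rV[R]_d) (g : 'rV[R]_d -> R) w :
  bounded_set B -> (forall x, g x != 0 -> B x) ->
  linear_statistic Lambda (fun x => (g x)%:C%C) w = (counting_sum B g w)%:C%C.
Proof.
move=> bB gB; rewrite /linear_statistic /counting_sum.
rewrite -(@fsbig_widen _ _ _ _ (Lambda w `&` B) (Lambda w)); first last.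
- move=> x [Lx nB] /=; have [->//|/gB Bx] := eqVneq (g x) 0.
  by exfalso; apply: nB.
- exact: subIsetl.
have fA := finiteL w bB.
by rewrite !fsbig_finite// rmorph_sum.
Qed.

Lemma counting_sum_le (B : set 'rV[R]_d) (g : 'rV[R]_d -> R) (M : R) w :
  bounded_set B -> (forall x, `|g x| <= M) ->
  `|counting_sum B g w| <= M * (npoints (Lambda w `&` B))%:R.
Proof.
move=> bB gM; have fA := finiteL w bB; rewrite /counting_sum fsbig_finite//.
apply: (le_trans (ler_norm_sum _ _ _)).
apply: (@le_trans _ _ (\sum_(x <- fset_set (Lambda w `&` B)) M)).
  by apply: ler_sum => x _; exact: gM.
by rewrite big_const_seq count_predT iter_addr addr0 mulr_natr.
Qed.

(** The sum is at most [M] times the number of points in [B], whose square is integrable by local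
    square-integrability. *)
Lemma integrable_sqr_counting_sum (B : set 'rV[R]_d) (g : 'rV[R]_d -> R) (M : R) (c : R[i]) :
  locally_square_integrable P Lambda ->
  measurable B -> bounded_set B -> measurable_fun setT g -> (forall x, 0 <= g x <= M) ->
  P.-integrable setT (fun w => (sqr_normc ((counting_sum B g w)%:C%C - c))%:E).
Proof.
move=> sqL mB bB mg gM.
have mS : measurable_fun setT (counting_sum B g).
  by apply: measurable_counting_sum => // x; have /andP[] := gM x.
(* The constant left over from [(s - Re c)^2 + (Im c)^2 <= 2 s^2 + 2 (Re c)^2 + (Im c)^2]. *)
pose K := 2 * complex.Re c ^+ 2 + complex.Im c ^+ 2.
have K0 : 0 <= K.
  have := sqr_ge0 (complex.Re c); have := sqr_ge0 (complex.Im c); rewrite /K; lra.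
pose np w : R := (npoints (Lambda w `&` B))%:R.
have mnp : measurable_fun setT np.
  apply: (@measurableT_comp _ _ _ _ _ _ (fun n : nat => n%:R : R)) => //.
  exact: measurableN.
have inp : P.-integrable setT (EFin \o (fun w => np w ^+ 2)).
  apply/integrableP; split; first by apply/measurable_EFinP; exact: measurable_funX.
  under eq_integral do rewrite /= ger0_norm ?sqr_ge0//.
  by have := sqL B mB bB; rewrite unlock.
have sE w : sqr_normc ((counting_sum B g w)%:C%C - c) =
    (counting_sum B g w - complex.Re c) ^+ 2 + complex.Im c ^+ 2.
  by rewrite /sqr_normc; case: c {K K0} => [a b] /=; rewrite sub0r sqrrN.
have idom : P.-integrable setT (EFin \o (fun w => 2 * M ^+ 2 * np w ^+ 2 + K)).
  have iK : P.-integrable setT (EFin \o cst K) by exact: finite_measure_integrable_cst.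
  exact: (integrableD measurableT (integrableZl measurableT (2 * M ^+ 2) inp) iK).
apply: le_integrable idom => //.
  apply/measurable_EFinP; under eq_fun do rewrite sE.
  apply: measurable_funD => //; apply: measurable_funX.
  exact: measurable_funB.
move=> w _; rewrite /= lee_fin.
rewrite ger0_norm ?sqr_normc_ge0// ger0_norm; last first.
  by rewrite addr_ge0// mulr_ge0 ?sqr_ge0// mulr_ge0 ?sqr_ge0.
have h1 : counting_sum B g w ^+ 2 <= M ^+ 2 * np w ^+ 2.
  rewrite -exprMn -real_normK ?num_real//.
  have h0 : `|counting_sum B g w| <= M * np w.
    by apply: counting_sum_le => // x; have /andP[? ?] := gM x; rewrite ger0_norm.
  by rewrite lerXn2r ?nnegrE// (le_trans _ h0).
rewrite sE /K; have := sqr_ge0 (counting_sum B g w + complex.Re c).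
nra.
Qed.

End counting.

(** * Pointwise convergence of the bumps to 1 *)

Section bump_limits.
Context {R : realType}.

Lemma horner_bump_poly N (x : R) : (bump_poly N).[x] = (1 - x ^+ 2) ^+ N.
Proof. by rewrite /bump_poly horner_exp !hornerE. Qed.

Definition cube {d} (L : R) : set 'rV[R]_d := [set x | forall i, - L <= x ord0 i <= L].

Lemma measurable_cube d L : measurable (@cube d L).
Proof.
rewrite (_ : @cube d L = \big[setI/setT]_(i < d) (fun x : 'rV[R]_d => x ord0 i) @^-1`
    `[- L, L]%classic).
  apply: bigsetI_measurable => i _; rewrite -[X in measurable X]setTI.
  by apply: measurable_coord => //; exact: measurable_itv.
rewrite -bigcap_seq; apply/seteqP; split => [x /= xA i _|x /= xA i].
  by rewrite /= in_itv/=; exact: xA.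
by have := xA i (mem_index_enum i); rewrite /= in_itv.
Qed.

Lemma bounded_cube d L : bounded_set (@cube d L).
Proof. by apply: (@bounded_set_coord _ _ _ L) => x i /(_ i); rewrite ler_norml. Qed.

Lemma box_fun_bump_ge0 d N L (x : 'rV[R]_d) : 0 < L ->
  0 <= box_fun (fun t => (bump_poly N).[L^-1 * t]) (- L) L x.
Proof.
move=> L0; apply: prodr_ge0 => i _; rewrite windowE; case: ifPn => // /andP[h1 h2].
rewrite horner_bump_poly exprn_ge0// subr_ge0 -[leRHS](expr1n _ 2).
rewrite -real_normK ?num_real// lerXn2r ?nnegrE//.
rewrite normrM (@ger0_norm _ L^-1) ?invr_ge0 ?(ltW L0)// ler_pdivrMl// mulr1.
by rewrite ler_norml h1.
Qed.

(** In each coordinate the cut-off is eventually inactive at a fixed point, and there the polynomial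
    is evaluated at a point tending to 0, where its value is 1. *)
Lemma box_fun_bump_cvg1 d N (L : nat -> R) (x : 'rV[R]_d) :
  (forall n, 0 < L n) -> (L n)^-1 @[n --> \oo] --> 0 ->
  box_fun (fun t => (bump_poly N).[(L n)^-1 * t]) (- L n) (L n) x @[n --> \oo] --> (1 : R).
Proof.
move=> L0 Lcvg; rewrite /box_fun.
rewrite [X in _ --> X](_ : _ = \prod_(i < d) (1 : R)); last by rewrite big1.
apply: cvg_big => [|i _]; first exact: mul_continuous.
set t := x ord0 i.
have Lt : (L n)^-1 * t @[n --> \oo] --> 0.
  by rewrite -(mul0r t); apply: cvgM => //; exact: cvg_cst.
have pLt : (bump_poly N).[(L n)^-1 * t] @[n --> \oo] --> (1 : R).
  rewrite (_ : 1 = (bump_poly N).[0 : R]); last first.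
    by rewrite horner_bump_poly expr0n subr0 expr1n.
  by apply: continuous_cvg Lt; exact: continuous_horner.
apply: cvg_trans pLt; apply: near_eq_cvg.
have : \forall n \near \oo, `|(L n)^-1 * t| < 1.
  by apply: (cvgr_lt (0 : R)) => //; rewrite -(@normr0 _ R); exact: cvg_norm.
apply: filterS => n; rewrite normrM (@ger0_norm _ (L n)^-1) ?invr_ge0 ?(ltW (L0 n))//.
by rewrite ltr_pdivrMl// mulr1 => /ltW; rewrite ler_norml windowE => ->.
Qed.

End bump_limits.

(** * Number rigidity *)

Lemma cvg_infty_ge (phi : nat -> nat) : (forall k, (k <= phi k)%N) ->
  phi k @[k --> \oo] --> \oo.
Proof.
move=> H A [N _ NA]; exists N => // n /= Nn.
by apply: NA => /=; exact: leq_trans (H n).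
Qed.

(** Since [s n] is real, [|s n - Re (c n)|] is at most the modulus of [s n - c n]. *)
Lemma cvg_sqr_normc0 (R : realType) (s : nat -> R) (c : nat -> R[i]) :
  sqr_normc ((s n)%:C%C - c n) @[n --> \oo] --> 0 ->
  s n - complex.Re (c n) @[n --> \oo] --> 0.
Proof.
move=> H.
have sH : Num.sqrt (sqr_normc ((s n)%:C%C - c n)) @[n --> \oo] --> 0.
  rewrite -[X in _ --> X](@sqrtr0 R).
  by apply: continuous_cvg H; exact: sqrt_continuous.
apply/norm_cvg0P; apply: (squeeze_cvgr _ (cvg_cst 0) sH).
apply: nearW => n; rewrite normr_ge0/= -sqrtr_sqr ler_sqrt ?sqr_normc_ge0//.
by rewrite /sqr_normc; case: (c n) => [a b] /=; rewrite lerDl sqr_ge0.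
Qed.

Theorem lemma1p10 (R : realType) (d : nat) (disp : measure_display)
    (Omega : measurableType disp) (P : probability Omega R)
    (act : 'rV[R]_d -> Omega -> Omega) (Lambda : Omega -> set 'rV[R]_d)
    (etahat : {measure set 'rV[R]_d -> \bar R}) :
  standard_borel R Omega ->
  pmp_action P act ->
  invariant_point_process act Lambda ->
  locally_square_integrable P Lambda ->
  is_centered_diffraction P Lambda etahat ->
  (exists (delta : R) (eps : nat -> R),
    [/\ 0 < delta,
        forall n, 0 < eps n,
        nonincreasing_seq eps,
        eps n @[n --> \oo] --> (0 : R) &
        exists C : R, forall n,
          (etahat (eball (eps n)) <= (C * eps n `^ (2 * d%:R + delta))%:E)%E]) ->
  number_rigid P Lambda.
Proof.
move=> _ _ [finL mN _] sqL [eta Hac [_ Hft]].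
move=> [delta [eps [delta0 eps0 _ epscvg [C HC]]]].
have hint f (tf : test_function f) := (Hft f tf).1.
have [N [L [L0 Linv Lcvg]]] := diffraction_bump_cvg0 hint delta0 eps0 epscvg HC.
pose g n : 'rV[R]_d -> R := box_fun (fun t => (bump_poly N).[(L n)^-1 * t]) (- L n) (L n).
pose S n w := counting_sum Lambda (cube (L n)) (g n) w.
have gcube n x : g n x != 0 -> cube (L n) x by exact: box_fun_support.
have SE n w : linear_statistic Lambda (bump_fun N (L n)) w = (S n w)%:C%C.
  exact: (linear_statistic_counting_sum finL w (@bounded_cube R d (L n)) (gcube n)).
pose c n := cintegral P (linear_statistic Lambda (bump_fun N (L n))).
pose Y n w := sqr_normc ((S n w)%:C%C - c n).
have iY n : P.-integrable setT (EFin \o Y n).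
  have cu : continuous (fun t => (bump_poly N).[(L n)^-1 * t]) by exact: continuous_hornerM.
  have [M _ gM] := @box_fun_bounded _ d _ (- L n) (L n) cu.
  apply: (@integrable_sqr_counting_sum _ _ _ _ _ _ finL mN _ _ M) => //.
  - exact: measurable_cube.
  - exact: bounded_cube.
  - exact: measurable_box_fun.
  - move=> x; apply/andP; split; first exact: box_fun_bump_ge0.
    by apply: le_trans (ler_norm _) (gM x).
(* The autocorrelation and its Fourier transform express the same quantity, so the variance of the
   statistic equals the diffraction integral, which tends to 0. *)
have Ycvg : \int[P]_w Y n w @[n --> \oo] --> 0.
  rewrite (_ : (fun n => _) =
    (fun n => \int[etahat]_xi sqr_normc (fourier (bump_fun N (L n)) xi)))//.
  apply/funext => n; have tf := @test_function_bump_fun R d N (L n).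
  have := Hac _ tf; rewrite (Hft _ tf).2 => /(congr1 (@complex.Re R)) /= ->.
  by rewrite /cvariance; apply: eq_Rintegral => w _; rewrite SE.
have [phi [phik Yae]] := L1_cvg_subseq_ae iY (fun n w => sqr_normc_ge0 _) Ycvg.
(* The conull set is where the centred statistics converge along [phi]; the same set serves for
   every [B]. *)
move=> B mB bB; exists [set w | Y (phi k) w @[k --> \oo] --> 0]; first exact: Yae.
move=> w w' /= /cvg_sqr_normc0 Hw /cvg_sqr_normc0 Hw' ww'.
have phioo := cvg_infty_ge phik.
have Lphi : (L (phi k))^-1 @[k --> \oo] --> 0 by exact: cvg_comp phioo Linv.
pose T n v := \sum_(x \in Lambda v `&` B) g n x.
(* The second sum depends on the configuration only through its part outside [B]. In [T] the
   restriction to the cube is dropped because [g n] vanishes off it. *)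
have TU n v : S n v = T n v + \sum_(x \in (Lambda v `&` ~` B) `&` cube (L n)) g n x.
  rewrite /S /counting_sum (fsbigID B); last exact: finL (@bounded_cube R d (L n)).
  congr (_ + _); last by rewrite setIAC.
  rewrite setIAC; apply: fsbig_widen; first exact: subIsetl.
  move=> x [LBx nx] /=; have [//|/gcube cx] := eqVneq (g n x) 0.
  by exfalso; apply: nx.
have Tcvg v : T (phi k) v @[k --> \oo] --> ((npoints (Lambda v `&` B))%:R : R).
  have fB := finL v _ bB.
  rewrite (_ : (fun k => _) = (fun k => \sum_(x <- fset_set (Lambda v `&` B)) g (phi k) x)); last first.
    by apply/funext => k; rewrite /T fsbig_finite.
  rewrite (_ : _%:R = \sum_(x <- fset_set (Lambda v `&` B)) (1 : R)); last first.
    by rewrite big_const_seq count_predT iter_addr addr0.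
  apply: cvg_big => [|x _]; first exact: add_continuous.
  exact: box_fun_bump_cvg1.
(* The centring constants do not depend on the configuration, and the sums outside [B] agree for [w]
   and [w'], so both cancel in the difference. *)
have D0 : T (phi k) w - T (phi k) w' @[k --> \oo] --> (0 : R).
  rewrite -(subrr (0 : R)) (_ : (fun k => _) =
    (fun k => (S (phi k) w - complex.Re (c (phi k))) -
              (S (phi k) w' - complex.Re (c (phi k))))); first exact: cvgB Hw Hw'.
  by apply/funext => k; rewrite !TU ww'; ring.
have hR := @norm_hausdorff R R.
have E : 0 = (npoints (Lambda w `&` B))%:R - (npoints (Lambda w' `&` B))%:R :> R.
  by rewrite -(cvg_lim hR D0); apply: (cvg_lim hR); exact: cvgB.
by apply/eqP; rewrite -(eqr_nat R) -subr_eq0 -E.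
Qed.
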